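(* Let $f:X\to X$ be the one-sided full shift over an alphabet with 4 symbols. Then there exist $\Phi\in C(X,\mathbb R^2)$ and a direction vector $\alpha\in S^1$ such that the face $F_\alpha(\Phi)$ of $\mathrm{Rot}(\Phi)$ is a (non-degenerate) line segment and: (i) $\partial\,\mathrm{Rot}(\Phi)$ is an infinite polygon; (ii) $GS(\alpha)=\{\mu_\alpha\}$ for a single measure $\mu_\alpha$, $\mu_\alpha$ is non-ergodic, and $\mathrm{rv}(\mu_\alpha)$ lies in the (relative) interior of the segment $F_\alpha(\Phi)$; (iii) $\mathrm{rv}(GS(\alpha'))\cap F_\alpha(\Phi)=\emptyset$ for all direction vectors $\alpha'\in S^1$ with $\alpha'\neq\alpha$.
   Context: $X=\{0,1,2,3\}^{\mathbb N}$ with the product topology; $\mathcal M$ denotes the set of $f$-invariant Borel probability measures with the weak$^*$ topology. An equilibrium state of a continuous $\varphi:X\to\mathbb R$ is a $\mu\in\mathcal M$ maximizing $h_\nu(f)+\int\varphi\,d\nu$ over $\nu\in\mathcal M$ ($h_\nu(f)$ is measure-theoretic entropy); $ES(\varphi)$ is the set of these. A ground state of $\varphi$ is a $\mu\in\mathcal M$ for which there are an increasing sequence $t_n\to\infty$ and $\mu_{t_n}\in ES(t_n\varphi)$ with $\mu_{t_n}\to\mu$ weak$^*$. For $\Phi=(\phi_1,\phi_2)$ continuous, $\mathrm{rv}(\mu)=(\int\phi_1\,d\mu,\int\phi_2\,d\mu)$ and $\mathrm{Rot}(\Phi)=\{\mathrm{rv}(\mu):\mu\in\mathcal M\}$, a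 compact convex subset of $\mathbb R^2$. For $\alpha\in S^{1}$ (direction vectors), $\alpha\cdot\Phi=\alpha_1\phi_1+\alpha_2\phi_2$, $GS(\alpha)$ is the set of ground states of $\alpha\cdot\Phi$, $H_\alpha(\Phi)=\{u\in\mathbb R^2:\alpha\cdot u=\max_{w\in\mathrm{Rot}(\Phi)}\alpha\cdot w\}$, and $F_\alpha(\Phi)=\mathrm{Rot}(\Phi)\cap H_\alpha(\Phi)$. The boundary of a compact convex set $K\subset\mathbb R^2$ with non-empty interior is called an infinite polygon if the set of extreme points (vertices) of $K$ is countably infinite. *)

(* Defs.v *)
From HB Require Import structures.
From mathcomp Require Import all_boot all_order all_algebra.
From mathcomp Require Import all_classical all_reals all_analysis.
From mathcomp Require Import giry.

Set Implicit Arguments.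
Unset Strict Implicit.
Unset Printing Implicit Defensive.

Import Order.TTheory GRing.Theory Num.Theory.
Import numFieldNormedType.Exports.

Local Open Scope classical_set_scope.
Local Open Scope ring_scope.

HB.instance Definition _ := isPointed.Build 'I_4 ord0.

(* Topology: product of discrete topologies; sigma-algebra: Borel. *)
Definition fullX : Type := prod_topology (fun _ : nat => discrete_topology 'I_4).

HB.instance Definition _ := Pointed.on fullX.
HB.instance Definition _ := Topological.on fullX.
HB.instance Definition _ :=
  Measurable.copy fullX (g_sigma_algebraType (@open fullX)).

Definition full_shift (x : fullX) : fullX := fun n => x n.+1.

Section measure_theoretic_entropy.
Context d (T : measurableType d) (R : realType).
Implicit Types (f : T -> T) (mu : probability T R).

Definition invariant_measure f mu :=
  forall A, measurable A -> mu (f @^-1` A) = mu A.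

Definition ergodic f mu :=
  invariant_measure f mu /\
  forall A, measurable A -> f @^-1` A = A -> mu A = 0%E \/ mu A = 1%E.

(* Empty cells are allowed: they contribute 0 to the entropy. *)
Definition measurable_partition (k : nat) (P : 'I_k -> set T) :=
  [/\ forall i, measurable (P i), trivIset setT P & \bigcup_i P i = setT].

Definition join_cell f (k : nat) (P : 'I_k -> set T) (n : nat)
    (w : {ffun 'I_n -> 'I_k}) : set T :=
  \bigcap_(i : 'I_n) (iter i f @^-1` P (w i)).

(* -x ln x, with value 0 at 0 since 0 is absorbing and ln 0 is finite. *)
Definition entropy_fun (x : R) : R := - (x * ln x).

Definition join_entropy f mu (k : nat) (P : 'I_k -> set T) (n : nat) : R :=
  \sum_(w : {ffun 'I_n -> 'I_k}) entropy_fun (fine (mu (join_cell f P w))).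

(* The limit exists, by subadditivity, when mu is f-invariant. *)
Definition partition_entropy f mu (k : nat) (P : 'I_k -> set T) : R :=
  limn (fun n : nat => join_entropy f mu P n / n%:R).

Definition entropy f mu : \bar R :=
  ereal_sup [set h | exists (k : nat) (P : 'I_k -> set T),
    measurable_partition P /\ h = (partition_entropy f mu P)%:E].

End measure_theoretic_entropy.

Section planar_convexity.
Context {R : realType}.
Implicit Types (u v a b : 'rV[R]_2) (K : set 'rV[R]_2).

Definition dot u v : R := \sum_(i < 2) u 0 i * v 0 i.

Definition direction : set 'rV[R]_2 := [set u | dot u u = 1].

Definition closed_segment a b : set 'rV[R]_2 :=
  [set (1 - t) *: a + t *: b | t in [set t : R | 0 <= t <= 1]].

Definition open_segment a b : set 'rV[R]_2 :=
  [set (1 - t) *: a + t *: b | t in [set t : R | 0 < t < 1]].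

Definition extreme_points K : set 'rV[R]_2 :=
  [set u | K u /\ forall v w (t : R), K v -> K w -> 0 < t < 1 ->
                    u = (1 - t) *: v + t *: w -> v = u /\ w = u].

(* A property of K, expressing that the boundary of K is an infinite polygon. *)
Definition infinite_polygon K :=
  [/\ compact K, convex_set K, K° !=set0,
      infinite_set (extreme_points K) & countable (extreme_points K)].

Definition is_max (A : set R) (m : R) := A m /\ ubound A m.

End planar_convexity.

Section thermodynamic_formalism.
Context {R : realType}.
Local Notation prob := (probability fullX R).
Implicit Types (phi : fullX -> R) (Phi : fullX -> 'rV[R]_2) (alpha : 'rV[R]_2).

Definition invariant_measures : set prob := [set mu | invariant_measure full_shift mu].

Definition free_energy phi (mu : prob) : \bar R :=
  (entropy full_shift mu + (\int[mu]_x phi x)%R%:E)%E.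

Definition ES phi : set prob :=
  [set mu | invariant_measures mu /\
            forall nu, invariant_measures nu ->
              (free_energy phi nu <= free_energy phi mu)%E].

Definition weak_star_cvg (mus : nat -> prob) (mu : prob) :=
  forall psi : fullX -> R, continuous psi ->
    (\int[mus n]_x psi x) @[n --> \oo] --> \int[mu]_x psi x.

Definition ground_states phi : set prob :=
  [set mu | invariant_measures mu /\
            exists (t : nat -> R) (mus : nat -> prob),
              [/\ increasing_seq t,
                  t n @[n --> \oo] --> +oo,
                  forall n, ES (fun x => t n * phi x) (mus n)
                & weak_star_cvg mus mu]].

Definition rv Phi (mu : prob) : 'rV[R]_2 := \row_i \int[mu]_x Phi x 0 i.

Definition Rot Phi : set 'rV[R]_2 := rv Phi @` invariant_measures.

Definition GS Phi alpha : set prob :=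
  ground_states (fun x => dot alpha (Phi x)).

Definition support_line Phi alpha : set 'rV[R]_2 :=
  [set u | is_max (dot alpha @` Rot Phi) (dot alpha u)].

Definition face Phi alpha : set 'rV[R]_2 := Rot Phi `&` support_line Phi alpha.

(* A library probability is a function on all subsets, unconstrained on the
   non-measurable ones, so measures are identified up to measure_eq, that is,
   equality on Borel sets. *)
Definition is_singleton_measure (S : set prob) (mu : prob) :=
  forall nu, S nu <-> measure_eq nu mu.

End thermodynamic_formalism.

(* Main.v *)
(** Take [alpha = (1, 0)], let [phi1 x] be [0] if [x 0 = x 1] and [-1] otherwise,
    and let [phi2 x = +/- (1 + 1 / k)], where [k] is the length of the initial run of
    [x] and the sign depends on the class [{0, 1}] or [{2, 3}] of [x 0].

    The equilibrium state of [t * phi1] is the Markov measure with uniform marginal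
    whose transitions are proportional to [1] on the diagonal and to [exp (- t)] off
    it: Gibbs' inequality bounds the entropy of an invariant measure by minus the
    integral of the logarithm of any g-function, and taking for the g-function the
    conditional probabilities of the measure itself settles the equality case.  As
    [t] tends to infinity these Markov measures converge to the mean of the Dirac
    masses at the four fixed points, which is not ergodic and is sent to [(0, 0)].

    Since [|phi2|] is dominated by combinations of the shifts of [- phi1], up to a
    constant, the rotation set is cut out by the chords between consecutive points
    [(- 1 / n, +/- (1 + H_n / n))], [H_n] being the harmonic numbers; these points are
    realized by the periodic orbits of [0^n 1^n] and [2^n 3^n].  They accumulate at the
    end points [(0, +/- 1)] of the face in the direction [alpha], and since [H_n] is
    unbounded no other direction exposes a point of that face. *)

Require Import Defs.
From HB Require Import structures.
From mathcomp Require Import all_boot all_order all_algebra.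
From mathcomp Require Import all_classical all_reals all_analysis.
From mathcomp Require Import measurable_realfun giry lra ring zify.
Set Implicit Arguments.
Unset Strict Implicit.
Unset Printing Implicit Defensive.
Import Order.TTheory GRing.Theory Num.Theory.
Import numFieldNormedType.Exports.
Local Open Scope classical_set_scope.
Local Open Scope ring_scope.

(** * Cylinders and the Borel sigma-algebra *)

(** Entropy is a supremum over all finite Borel partitions, so the bound by a g-function has to hold
    for each of them. Such a partition agrees, off a set of small measure, with one that depends on
    finitely many coordinates, and Gibbs' inequality is applied jointly to the names for the true
    partition and to the words; the cost of guessing the former from the latter tends to 0. The
    matching lower bound for the Markov measures is read off the partition by the first letter.

    The shape of [phi2] comes from the face: if the boundary left its end points with finite slope,
    each would be a corner, exposed by a whole cone of directions. Along a run of length [n] the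
    letter changes have frequency [1 / n] and the average of [1 / k] is [H_n / n], so the chords
    have slopes of the order of [H_n] and the boundary is tangent to the face.

    No equilibrium state is computed for the other directions. Entropy lies between 0 and [ln 4], so
    every ground state maximizes the integral of its potential, which confines its rotation vector
    to the face of its own direction; that face misses the one of [alpha]. *)

Definition cyl (x : fullX) n : set fullX :=
  [set y | forall i, (i < n)%N -> y i = x i].

Lemma cyl_sym x y n : cyl x n y -> cyl y n x.
Proof. by move=> h i /h. Qed.

Lemma cyl_eq x y n : cyl x n y -> cyl x n = cyl y n.
Proof. by move=> h; apply/seteqP; split=> z hz i lt; rewrite hz ?h. Qed.

Lemma cyl_le x m n : (m <= n)%N -> cyl x n `<=` cyl x m.
Proof. by move=> mn y h i im; apply: h; exact: leq_trans mn. Qed.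

Lemma letter_continuous i : continuous (fun x : fullX => x i : discrete_topology 'I_4).
Proof.
exact: (@proj_continuous nat (fun _ => discrete_topology 'I_4) i).
Qed.

Lemma nbhs_cyl x n : nbhs x (cyl x n).
Proof.
elim: n => [|n ih].
  by apply: (@filterS _ (nbhs x) _ setT) => [y _ i //|]; exact: filterT.
have : nbhs x ((fun y : fullX => y n : discrete_topology 'I_4) @^-1` [set x n]).
  exact/letter_continuous/(@discrete_set1 (discrete_topology 'I_4)).
move=> hn; apply: filterS (filterI ih hn) => y /= [hy yn] i.
by rewrite ltnS leq_eqVlt => /orP[/eqP ->//|]; exact: hy.
Qed.

Lemma nbhs_cylP (x : fullX) U : nbhs x U -> exists n, cyl x n `<=` U.
Proof.
pose F : set_system fullX := [set V | exists n, cyl x n `<=` V].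
have FF : Filter F.
  split.
  - by exists 0%N.
  - move=> P Q [m hm] [n hn]; exists (maxn m n) => y hy; split.
      by apply: hm; apply: cyl_le hy; rewrite leq_maxl.
    by apply: hn; apply: cyl_le hy; rewrite leq_maxr.
  - by move=> P Q PQ [m hm]; exists m => y /hm /PQ.
(* Convergence in a product is tested on one coordinate at a time, and coordinate [N] is fixed on
   [cyl x N.+1]. *)
suff : F --> x by apply.
apply/cvg_sup => N V [W [[B oB <-] /= xB WV]].
by exists N.+1 => y hy; apply: WV => /=; rewrite hy.
Qed.

Lemma open_cyl x n : open (cyl x n).
Proof.
rewrite openE => y hy; rewrite /interior (cyl_eq hy); exact: nbhs_cyl.
Qed.

Lemma cyl_continuous (T : topologicalType) (F : fullX -> T) n :
  (forall x y, cyl x n y -> F y = F x) -> continuous F.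
Proof.
move=> hF x U /nbhs_singleton UFx.
by apply: filterS (nbhs_cyl x n) => y /hF /= ->.
Qed.

Lemma fullX_compact : compact [set: fullX].
Proof.
have := @tychonoff nat (fun=> discrete_topology 'I_4) (fun=> setT)
  (fun=> @finite_compact (discrete_topology 'I_4) _ (@finite_finset 'I_4 setT)).
by congr (compact _); rewrite eqEsubset.
Qed.

Definition ext (s : seq 'I_4) : fullX := fun i => nth ord0 s i.

Definition word (x : fullX) n : seq 'I_4 := mkseq x n.

Lemma size_word x n : size (word x n) = n.
Proof. by rewrite size_mkseq. Qed.

Lemma cyl_word x n : cyl x n (ext (word x n)).
Proof. by move=> i lt; rewrite /ext nth_mkseq. Qed.

Lemma cylP x y n : cyl x n y <-> word y n = word x n.
Proof.
split=> [h|h i lt].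
  apply: (@eq_from_nth _ ord0); rewrite !size_word// => i lt.
  by rewrite !nth_mkseq// h.
by have := congr1 (fun s => nth ord0 s i) h; rewrite !nth_mkseq.
Qed.

(** The empty set is included to make the family closed under intersection, so that it determines a
    probability. *)
Definition cylinders : set (set fullX) :=
  [set A | A = set0 \/ exists x n, A = cyl x n].

Lemma measurable_open (U : set fullX) : open U -> measurable U.
Proof. exact: sub_sigma_algebra. Qed.

Lemma measurable_cyl x n : measurable (cyl x n).
Proof. by apply: measurable_open; exact: open_cyl. Qed.

(** There are countably many words, so an open set is a countable union of cylinders. *)
Lemma fullX_measurableE : (measurable : set (set fullX)) = <<s cylinders >>.
Proof.
apply/seteqP; split.
  apply: smallest_sub; first exact: smallest_sigma_algebra.
  move=> U oU.
  pose I := [set s : seq 'I_4 | cyl (ext s) (size s) `<=` U].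
  have -> : U = \bigcup_(s in I) cyl (ext s) (size s).
    apply/seteqP; split=> [x Ux|x [s Is]]; last exact: Is.
    have [n hn] : exists n, cyl x n `<=` U by apply: nbhs_cylP; exact: open_nbhs_nbhs.
    have xs : cyl (ext (word x n)) (size (word x n)) = cyl x n.
      by rewrite size_word -(cyl_eq (@cyl_word x n)).
    by exists (word x n); rewrite /I /= xs.
  pose T := g_sigma_algebraType cylinders.
  suff : measurable (\bigcup_(s in I) cyl (ext s) (size s) : set T) by [].
  rewrite bigcup_mkcond; apply: countable_bigcupT_measurable => //.
  move=> s; case: ifPn => _ //.
  by apply: sub_sigma_algebra; right; exists (ext s), (size s).
apply: smallest_sub; first exact: sigma_algebra_measurable.
by move=> _ [->|[x [n ->]]]; [exact: measurable0|exact: measurable_cyl].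
Qed.

Lemma cylindersI : setI_closed cylinders.
Proof.
move=> A B [->|[x [m ->]]]; first by rewrite set0I => _; left.
move=> [->|[y [n ->]]]; first by rewrite setI0; left.
have [[z [zx zy]]|h] := pselect (exists z, cyl x m z /\ cyl y n z); last first.
  by left; apply/seteqP; split => // z [zx zy]; apply: h; exists z.
right; exists z, (maxn m n); rewrite (cyl_eq zx) (cyl_eq zy).
apply/seteqP; split=> [w [wm wn] i|w hw].
  by rewrite leq_max => /orP[/wm|/wn].
by split; apply: cyl_le hw; rewrite ?leq_maxl ?leq_maxr.
Qed.

Section with_real.
Context {R : realType}.
Local Notation prob := (probability fullX R).
Implicit Types mu nu : prob.

Lemma prob_eq_cyl mu nu : (forall x n, mu (cyl x n) = nu (cyl x n)) ->
  measure_eq mu nu.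
Proof.
move=> h A mA; apply: (measure_unique cylinders (fun=> setT)) => //.
- exact: fullX_measurableE.
- exact: cylindersI.
- by move=> _; right; exists (ext [::]), 0%N; apply/seteqP; split.
- by rewrite bigcup_const.
- move=> B [->|[x [n ->]]]; last exact: h.
  by rewrite (measure0 mu) (measure0 nu).
- by move=> _; exact: le_lt_trans (probability_le1 mu measurableT) (ltry _).
Qed.

End with_real.

(** * Integrals of bounded measurable functions *)

Section bounded_measurable.
Context d (T : measurableType d) {R : realType}.
Implicit Types (mu : probability T R) (F G : T -> R).

Definition bounded_measurable F :=
  measurable_fun setT F /\ exists M : R, forall x, `|F x| <= M.

Lemma bmeas_integrable mu F :
  bounded_measurable F -> mu.-integrable setT (EFin \o F).
Proof.
move=> [mF [M hM]]; apply: measurable_bounded_integrable => //.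
  exact: le_lt_trans (probability_le1 mu measurableT) (ltry _).
exists M; split; first exact: num_real.
by move=> x Mx y _ /=; exact: le_trans (hM y) (ltW Mx).
Qed.

Lemma bmeas_cst c : bounded_measurable (fun=> c).
Proof. by split; [exact: measurable_cst|exists `|c|]. Qed.

Lemma bmeasD F G : bounded_measurable F -> bounded_measurable G ->
  bounded_measurable (fun x => F x + G x).
Proof.
move=> [mF [M hM]] [mG [N hN]]; split; first exact: measurable_funD.
by exists (M + N) => x; apply: (le_trans (ler_normD _ _)); exact: lerD.
Qed.

Lemma bmeasZ c F : bounded_measurable F -> bounded_measurable (fun x => c * F x).
Proof.
move=> [mF [M hM]]; split; first exact: measurable_funM.
by exists (`|c| * M) => x; rewrite normrM ler_wpM2l.
Qed.

Lemma bmeas_sum (I : Type) (s : seq I) (F : I -> T -> R) :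
  (forall i, bounded_measurable (F i)) ->
  bounded_measurable (fun x => \sum_(i <- s) F i x).
Proof.
move=> h; elim: s => [|i s ih].
  by under eq_fun do rewrite big_nil; exact: bmeas_cst.
by under eq_fun do rewrite big_cons; exact: bmeasD.
Qed.

Lemma bmeas_indic A : measurable A -> bounded_measurable (\1_A : T -> R).
Proof.
move=> mA; split; first exact: measurable_indic.
by exists 1 => x; rewrite indicE; case: (_ \in _); rewrite ?normr1 ?normr0.
Qed.

Lemma int_cst mu c : \int[mu]_x c = c.
Proof.
rewrite Rintegral_cst//; transitivity (c * 1); last by rewrite mulr1.
by congr (c * _); exact: (congr1 fine (probability_setT mu)).
Qed.

Lemma intD mu F G : bounded_measurable F -> bounded_measurable G ->
  \int[mu]_x (F x + G x) = \int[mu]_x F x + \int[mu]_x G x.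
Proof. by move=> hF hG; rewrite RintegralD//; exact: bmeas_integrable. Qed.

Lemma intZ mu c F : bounded_measurable F ->
  \int[mu]_x (c * F x) = c * \int[mu]_x F x.
Proof. by move=> hF; rewrite RintegralZl//; exact: bmeas_integrable. Qed.

Lemma int_sum mu (I : Type) (s : seq I) (F : I -> T -> R) :
  (forall i, bounded_measurable (F i)) ->
  \int[mu]_x (\sum_(i <- s) F i x) = \sum_(i <- s) \int[mu]_x F i x.
Proof.
move=> h; elim: s => [|i s ih].
  by under eq_Rintegral do rewrite big_nil; rewrite int_cst big_nil.
under eq_Rintegral do rewrite big_cons.
by rewrite big_cons intD ?ih//; exact: bmeas_sum.
Qed.

Lemma int_le mu F G : bounded_measurable F -> bounded_measurable G ->
  (forall x, F x <= G x) -> \int[mu]_x F x <= \int[mu]_x G x.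
Proof. by move=> hF hG FG; apply: le_Rintegral => //; exact: bmeas_integrable. Qed.

Lemma int_indic mu A : measurable A -> \int[mu]_x \1_A x = fine (mu A).
Proof. by move=> mA; rewrite /Rintegral integral_indic// setIT. Qed.

Lemma bmeas_fin (I : finType) (k : T -> I) (F : I -> R) :
  (forall i, measurable (k @^-1` [set i])) -> bounded_measurable (fun x => F (k x)).
Proof.
move=> mk.
have -> : (fun x => F (k x)) =
    fun x => \sum_i F i * \1_(k @^-1` [set i]) x.
  apply/funext => x; rewrite (bigD1 (k x))//= big1 ?addr0.
    by rewrite indicE mem_set// mulr1.
  by move=> i ik; rewrite indicE memNset ?mulr0// => /= kx; rewrite kx eqxx in ik.
by apply: bmeas_sum => i; apply: bmeasZ; exact: bmeas_indic.
Qed.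

Lemma int_fin mu (I : finType) (k : T -> I) (F : I -> R) :
  (forall i, measurable (k @^-1` [set i])) ->
  \int[mu]_x F (k x) = \sum_i F i * fine (mu (k @^-1` [set i])).
Proof.
move=> mk.
transitivity (\int[mu]_x (\sum_i F i * \1_(k @^-1` [set i]) x)).
  apply: eq_Rintegral => x _; rewrite (bigD1 (k x))//= big1 ?addr0.
    by rewrite indicE mem_set// mulr1.
  by move=> i ik; rewrite indicE memNset ?mulr0// => /= kx; rewrite kx eqxx in ik.
rewrite int_sum; last by move=> i; apply: bmeasZ; exact: bmeas_indic.
by apply: eq_bigr => i _; rewrite intZ ?int_indic//; exact: bmeas_indic.
Qed.

Lemma bmeas_comp (f : T -> T) F : measurable_fun setT f ->
  bounded_measurable F -> bounded_measurable (fun x => F (f x)).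
Proof.
move=> mf [mF [M hM]]; split; last by exists M => x.
exact: measurableT_comp.
Qed.

Lemma int_invariant mu (f : T -> T) F : measurable_fun setT f ->
  invariant_measure f mu -> bounded_measurable F ->
  \int[mu]_x F (f x) = \int[mu]_x F x.
Proof.
move=> mf inv hF; rewrite /Rintegral; congr fine.
have [mF _] := hF.
transitivity (\int[pushforward mu f]_x (F x)%:E)%E.
  rewrite integral_pushforward//; first exact/measurable_EFinP.
  apply: (@bmeas_integrable mu (fun x => F (f x))).
  exact: bmeas_comp.
by apply: eq_measure_integral => A mA _; exact: inv.
Qed.

End bounded_measurable.

(** * Probabilities obtained from measures of mass one, and finite mixtures *)

Section probability_of_measure.
Context d (T : measurableType d) (R : realType).
Context (mu : {measure set T -> \bar R}) (mu1 : mu setT = 1%E).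

(** The proof that the mass is 1 is kept as an argument, so that the structure of probability can be
    attached to this copy of [mu]. *)
Definition prob_of_measure of mu setT = 1%E : set T -> \bar R := mu.
Local Notation P := (prob_of_measure mu1).
HB.instance Definition _ := Measure.copy P mu.
HB.instance Definition _ := Measure_isProbability.Build _ _ _ P mu1.

Lemma prob_of_measureP : exists P : probability T R, forall A, P A = mu A.
Proof. by exists P. Qed.

End probability_of_measure.

Section mixture.
Context d (T : measurableType d) (R : realType).
Local Open Scope ereal_scope.

Lemma mixture_exists n (w : 'I_n -> R) (m : 'I_n -> probability T R) :
  (forall i, 0 <= w i)%R -> (\sum_i w i = 1)%R ->
  exists mu : probability T R,
    (forall A, mu A = \sum_i (w i)%:E * m i A) /\
    forall F : T -> R, bounded_measurable F ->
      (\int[mu]_x F x = \sum_i w i * \int[m i]_x F x)%R.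
Proof.
case: n w m => [|n] w m w0 w1.
  by move: w1; rewrite big_ord0 => /eqP; rewrite eq_sym oner_eq0.
pose ms (k : nat) : {measure set T -> \bar R} :=
  mscale (NngNum (w0 (inord k))) (m (inord k)).
have msE A : msum ms n.+1 A = \sum_i (w i)%:E * m i A.
  by apply: eq_bigr => i _; rewrite /ms /mscale /= inord_val.
have ms1 : msum ms n.+1 setT = 1.
  rewrite msE -[RHS](congr1 EFin w1) -sumEFin; apply: eq_bigr => i _.
  by rewrite probability_setT mule1.
have [mu muE] := prob_of_measureP ms1.
exists mu; split; first by move=> A; rewrite muE; exact: msE.
move=> F hF; have [mF [M hM]] := hF.
have pos (G : T -> R) : measurable_fun setT G -> (exists M : R, forall x, `|G x| <= M)%R ->
    (forall x, 0 <= G x)%R -> (\int[mu]_x G x = \sum_i w i * \int[m i]_x G x)%R.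
  move=> mG bG G0; rewrite /Rintegral.
  have mG' : measurable_fun setT (EFin \o G) by exact/measurable_EFinP.
  rewrite (eq_measure_integral (msum ms n.+1)); last by move=> A _ _; exact: muE.
  rewrite ge0_integral_measure_sum//; last by move=> x _; rewrite lee_fin.
  transitivity (fine (\sum_(i < n.+1) (w i * \int[m i]_x G x)%:E)%R).
    congr fine; apply: eq_bigr => i _.
    rewrite [LHS]ge0_integral_mscale//= /ms ?inord_val; last by move=> x _; rewrite lee_fin.
    by rewrite EFinM /Rintegral fineK//; exact: integrable_fin_num (bmeas_integrable (m i) (conj mG bG)).
  by rewrite sumEFin.
(* Additivity in the measure is available for nonnegative functions. Adding the bound [M] reduces to
   that case, and [M] cancels since the weights sum to 1. *)
have hpos := pos (fun x => F x + M)%R.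
have bM : bounded_measurable (fun x => F x + M)%R by apply: bmeasD => //; exact: bmeas_cst.
have FM0 x : (0 <= F x + M)%R.
  by rewrite -lerBlDr sub0r; have := hM x; rewrite ler_norml => /andP[].
have := hpos bM.1 bM.2 FM0.
rewrite intD//; last exact: bmeas_cst.
rewrite int_cst.
under eq_bigr do (rewrite intD//; last exact: bmeas_cst).
under eq_bigr do rewrite int_cst mulrDr.
rewrite big_split /= -mulr_suml w1 mul1r => h.
by apply: (addIr M); exact: h.
Qed.
End mixture.

(** * The shift and continuous functions on the sequence space *)

Section fullX_integral.
Context {R : realType}.
Implicit Types (F : fullX -> R).

Lemma shift_continuous : continuous full_shift.
Proof.
move=> x U /nbhs_cylP[n hn]; apply: filterS (nbhs_cyl x n.+1) => y hy.
by apply: hn => i lt; exact: hy.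
Qed.

Lemma measurable_shift : measurable_fun setT full_shift.
Proof.
apply: (measurability (@open fullX) erefl) => _ [U oU <-]; rewrite setTI.
apply: measurable_open; apply: open_comp => // x _; exact: shift_continuous.
Qed.

Lemma continuous_bmeas F : continuous F -> bounded_measurable F.
Proof.
move=> cF; split.
  apply: (measurability _ (RGenOpens.measurableE R)) => _ [_ [a [b ->]] <-].
  rewrite setTI; apply: measurable_open; apply: open_comp; last exact: interval_open.
  by move=> x _; exact: cF.
have /compact_bounded [M [_ hM]] : compact (F @` setT).
  apply: continuous_compact fullX_compact; exact: continuous_subspaceT.
by exists (M + 1) => x; apply: hM; [rewrite ltrDl|exists x].
Qed.

(** Compactness: a sequence of counterexamples would cluster at a point having a cylinder around it
    on which [F] stays within [e / 2] of its value there. *)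
Lemma uniform_cyl F (e : R) : continuous F -> 0 < e ->
  exists n, forall x y, cyl x n y -> `|F y - F x| < e.
Proof.
move=> cF e0; apply: contrapT => /forallNP h.
have {h} h n : exists x, exists y, cyl x n y /\ ~ (`|F y - F x| < e).
  by have /existsNP[x /existsNP[y /not_implyP]] := h n; exists x, y.
have [u hu] := choice h.
have FF : ProperFilter (u @ \oo) by exact: fmap_proper_filter.
have [|x [_ clx]] := fullX_compact FF; first exact: filterT.
have e2 : 0 < e / 2 by rewrite divr_gt0.
have /nbhs_cylP[n hn] : nbhs x (F @^-1` ball (F x) (e/2)).
  by apply: cF; exact: nbhsx_ballx.
have [||_ [[k nk <-] xk]] := clx [set u k | k in [set k | n <= k]%N] (cyl x n).
- by exists n => // k /= nk; exists k.
- exact: nbhs_cyl.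
have [y [yk /negP]] := hu k.
rewrite -real_leNgt ?num_real// => /negP; apply; apply/negP; rewrite -ltNge.
have h1 := hn _ xk.
have h2 : ball (F x) (e/2) (F y).
  apply: hn => i lt; rewrite yk; last exact: leq_trans nk.
  exact: xk.
move: h1 h2; rewrite /ball /= => h1 h2.
by rewrite [e]splitr; rewrite (le_lt_trans (ler_distD (F x) _ _))// ltrD// distrC.
Qed.

End fullX_integral.

(** * Measures with prescribed values on cylinders *)

Section kolmogorov.
Context {R : realType} (m : seq 'I_4 -> R) (m_ge0 : forall s, 0 <= m s)
  (m_nil : m [::] = 1) (m_rcons : forall s, m s = \sum_a m (rcons s a)).

Let M s := m (rev s).

Let M_cons s : M s = \sum_a M (a :: s).
Proof. by rewrite /M m_rcons; apply: eq_bigr => a _; rewrite rev_cons. Qed.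

(* Words are read backwards here: the head of [s] is its last letter, so that the
   intervals of the words [a :: t] subdivide the one of [t], in the order of [a]. *)
Fixpoint left_end (s : seq 'I_4) : R :=
  if s is a :: t then left_end t + \sum_(c : 'I_4 | (c < a)%N) M (c :: t) else 0.

Definition word_itv s : set R := [set u | left_end s <= u < left_end s + M s].

Let next_sum t (a : 'I_4) : \sum_(c : 'I_4 | (c < a)%N) M (c :: t) + M (a :: t) =
  \sum_(c : 'I_4 | (c <= a)%N) M (c :: t).
Proof.
rewrite [RHS](bigD1 a)//= addrC; congr (_ + _); apply: eq_bigl => c.
by rewrite ltn_neqAle andbC.
Qed.

Let sum_mono t (P Q : pred 'I_4) : (forall c, P c -> Q c) ->
  \sum_(c | P c) M (c :: t) <= \sum_(c | Q c) M (c :: t).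
Proof.
move=> PQ; rewrite [leRHS](bigID P)/=.
rewrite [X in _ <= X + _](eq_bigl P) => [|c]; last first.
  by case: (boolP (P c)) => [/PQ Qc|_] /=; rewrite ?andbF ?Qc.
by rewrite lerDl sumr_ge0// => c _; exact: m_ge0.
Qed.

Lemma word_itv_sub a t : word_itv (a :: t) `<=` word_itv t.
Proof.
move=> u; rewrite /word_itv /= -addrA next_sum => /andP[h1 h2]; apply/andP; split.
  by apply: le_trans h1; rewrite lerDl sumr_ge0// => c _; exact: m_ge0.
by apply: (lt_le_trans h2); rewrite lerD2l (M_cons t); exact: sum_mono.
Qed.

Lemma word_itv_inj u a b t : word_itv (a :: t) u -> word_itv (b :: t) u -> a = b.
Proof.
wlog ab : a b / (a <= b)%N.
  by move=> h ha hb; have [/h|/ltnW/h] := leqP a b; [exact|move=> /(_ hb ha)].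
rewrite /word_itv /= => /andP[_ +] /andP[+ _]; rewrite -addrA next_sum.
move: ab; rewrite leq_eqVlt => /orP[/eqP ab _ _|ab h1 h2]; first exact: val_inj.
have := lt_le_trans (le_lt_trans h2 h1) (lexx _).
rewrite ltrD2l ltNge => /negP[]; apply: sum_mono => c ca.
exact: leq_ltn_trans ab.
Qed.

Lemma word_itv_next u t : word_itv t u -> exists a, word_itv (a :: t) u.
Proof.
rewrite /word_itv /= => /andP[h1 h2]; apply: contrapT => /forallNP h.
have {}h (k : nat) : (k <= 4)%N ->
    left_end t + \sum_(c : 'I_4 | (c < k)%N) M (c :: t) <= u.
  elim: k => [_|k ih k4]; first by rewrite big_pred0 ?addr0.
  have := h (Ordinal k4); rewrite /= => /negP; rewrite ih ?(ltnW k4)//=.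
  by rewrite -leNgt -addrA (next_sum t (Ordinal k4)).
have := h 4%N (leqnn _).
rewrite leNgt => /negP; apply; apply: (lt_le_trans h2).
by rewrite lerD2l (M_cons t) sum_mono.
Qed.

Definition next_letter u t : 'I_4 :=
  if [pick a | `[< word_itv (a :: t) u >]] is Some a then a else ord0.

Fixpoint coding_word u n : seq 'I_4 :=
  if n is k.+1 then next_letter u (coding_word u k) :: coding_word u k else [::].

Definition coding u : fullX := fun n => next_letter u (coding_word u n).

Lemma coding_wordE u n : coding_word u n = rev (word (coding u) n).
Proof.
elim: n => //= n ih; rewrite ih -ih /word -[n.+1]addn1 /mkseq iotaD map_cat /=.
by rewrite add0n cats1 rev_rcons -/(mkseq _ _) -/(word _ _) -ih.
Qed.

Lemma coding_wordP u s : word_itv [::] u ->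
  word_itv s u <-> coding_word u (size s) = s.
Proof.
move=> u0; elim: s => [|a t ih] //=; split.
  move=> h; have /ih th := word_itv_sub h.
  rewrite th; congr (_ :: _); rewrite /next_letter; case: pickP.
    by move=> b /asboolP hb; apply: word_itv_inj hb h.
  by move=> /(_ a) /asboolP.
move=> [+ th]; rewrite th => <-; move/ih : th => /word_itv_next [b hb].
rewrite /next_letter; case: pickP => [c /asboolP//|/(_ b) /asboolP].
by [].
Qed.

Lemma word_itvE s : word_itv s = `[left_end s, left_end s + M s[%classic.
Proof. by apply/seteqP; split => u /=; rewrite in_itv. Qed.

Let coding' u := if `[< word_itv [::] u >] then coding u else (fun=> ord0).

Lemma coding'_cyl x n :
  coding' @^-1` (cyl x n) `&` word_itv [::] = word_itv (rev (word x n)).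
Proof.
apply/seteqP; split=> u.
  rewrite /coding' /= => -[+ h]; case: asboolP => // _ /cylP e.
  by apply/coding_wordP => //; rewrite size_rev size_word coding_wordE e.
move=> h.
have h0 : word_itv [::] u.
  elim: (rev _) h => // a t ih /word_itv_sub; exact: ih.
split=> //; rewrite /coding' /=; case: asboolP => // _; apply/cylP.
move: h => /(coding_wordP _ h0); rewrite size_rev size_word coding_wordE.
by move/(can_inj revK).
Qed.

Lemma measurable_coding' : measurable_fun setT (coding' : measurableTypeR R -> fullX).
Proof.
apply: (measurability cylinders fullX_measurableE) => _ [_ [->|[x [n ->]]] <-].
  by rewrite preimage_set0 setI0.
rewrite setTI -(setIT (_ @^-1` _)) -(setUv (word_itv [::])) setIUr.
apply: measurableU.
  by rewrite coding'_cyl word_itvE; exact: measurable_itv.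
have mC : measurable (~` word_itv [::] : set (measurableTypeR R)).
  by apply: measurableC; rewrite word_itvE; exact: measurable_itv.
have [h|h] := pselect (cyl x n (fun=> ord0)).
  rewrite (_ : _ `&` _ = ~` word_itv [::])//.
  apply/seteqP; split=> [u []//|u hu]; split=> //.
  by rewrite /coding' /=; case: asboolP.
suff -> : coding' @^-1` cyl x n `&` ~` word_itv [::] = set0 by [].
apply/seteqP; split=> // u [+ hu].
by rewrite /coding' /=; case: asboolP.
Qed.

(** The measure is the image of Lebesgue measure on the unit interval under the map that reads off
    the nested intervals containing a point: the interval of a word has length the mass prescribed
    for it. *)
Lemma kolmogorov : exists mu : probability fullX R,
  forall x n, mu (cyl x n) = (m (word x n))%:E.
Proof.
have mI : measurable (word_itv [::] : set (measurableTypeR R)).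
  by rewrite word_itvE; exact: measurable_itv.
pose nu_of : {measure set fullX -> \bar R} :=
  pushforward (mrestr (@lebesgue_measure R) mI) (coding' : measurableTypeR R -> fullX).
pose nu := nu_of measurable_coding'.
have nuE x n : nu (cyl x n) = (m (word x n))%:E.
  rewrite /nu /nu_of /= /pushforward /mrestr coding'_cyl word_itvE lebesgue_measure_itv /=.
  rewrite lte_fin ltrDl; have [h|h] := ltP 0 (M (rev (word x n))).
    by rewrite -EFinB addrAC subrr add0r /M revK.
  by congr EFin; apply/eqP; rewrite eq_le m_ge0 -(revK (word x n)) h.
have nu1 : nu setT = 1%E.
  have := nuE (ext [::]) 0%N; rewrite /word /= m_nil => <-; congr (nu _).
  by apply/seteqP; split.
have [P hP] := prob_of_measureP nu1.
by exists P => x n; rewrite hP; exact: nuE.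
Qed.

End kolmogorov.

(** * The Gibbs bound on the entropy *)

Section gibbs.
Context {R : realType}.

(** This is [ln z <= z - 1] at [z = q / p]. The term [q - p] has nonpositive sum when [p] has mass 1
    and [q] at most 1; the equality case is what later gives uniqueness. *)
Lemma gibbs (p q : R) : 0 <= p -> 0 <= q -> (0 < p -> 0 < q) ->
  - (p * ln p) <= - (p * ln q) + (q - p) ?= iff (p == q).
Proof.
move=> p0 q0 pq.
have [->|pn0] := eqVneq p 0.
  by rewrite !mul0r oppr0 addr0 add0r; split => //; rewrite eq_sym.
have {}p0 : 0 < p by rewrite lt_neqAle eq_sym pn0.
have {}q0 := pq p0.
have qp0 : 0 < q / p by rewrite divr_gt0.
have lnE : ln (q / p) = ln q - ln p by rewrite ln_div// posrE.
have [pqE|pqE] := eqVneq p q.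
  by rewrite pqE subrr addr0; split => //; rewrite eqxx.
suff h : p * ln (q / p) < q - p.
  have h' : - (p * ln p) < - (p * ln q) + (q - p).
    by move: h; rewrite lnE mulrBr => h; lra.
  by split; [exact: ltW|rewrite lt_eqF].
have h : ln (q / p) < q / p - 1.
  rewrite -ltr_expR lnK ?posrE//.
  have /expR_gt1Dx : q / p - 1 != 0.
    rewrite subr_eq0; apply: contra pqE => /eqP e.
    by rewrite -(divfK pn0 q) e mul1r.
  by rewrite addrC subrK.
have : p * ln (q / p) < p * (q / p - 1) by rewrite ltr_pM2l.
by rewrite mulrBr mulr1 (mulrC p (q / p)) divfK.
Qed.

Lemma ln_prod (I : Type) (s : seq I) (F : I -> R) : (forall i, 0 < F i) ->
  ln (\prod_(i <- s) F i) = \sum_(i <- s) ln (F i).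
Proof.
move=> F0; elim: s => [|i s ih]; first by rewrite !big_nil ln1.
by rewrite !big_cons lnM ?posrE ?prodr_gt0// ih.
Qed.

End gibbs.

Section pr.
Context d (T : measurableType d) {R : realType} (mu : probability T R).

Definition pr A : R := fine (mu A).

Lemma prE A : measurable A -> mu A = (pr A)%:E.
Proof. by move=> mA; rewrite /pr fineK// fin_num_measure. Qed.

Lemma pr_ge0 A : 0 <= pr A. Proof. exact: fine_ge0. Qed.

Lemma prT : pr setT = 1. Proof. by rewrite /pr probability_setT. Qed.

Lemma pr0 : pr set0 = 0. Proof. by rewrite /pr measure0. Qed.

Lemma pr_le A B : measurable A -> measurable B -> A `<=` B -> pr A <= pr B.
Proof. by move=> mA mB AB; rewrite -lee_fin -!prE//; apply: le_measure; rewrite ?inE. Qed.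

Lemma prU_le A B : measurable A -> measurable B -> pr (A `|` B) <= pr A + pr B.
Proof.
move=> mA mB; rewrite -lee_fin EFinD -!prE//; last exact: measurableU.
exact: measureU2.
Qed.

Lemma pr_bigU_le (I : Type) (s : seq I) (A : I -> set T) (e : R) :
  (forall i, measurable (A i)) -> (forall i, pr (A i) <= e) ->
  measurable (\big[setU/set0]_(i <- s) A i) /\
  pr (\big[setU/set0]_(i <- s) A i) <= (size s)%:R * e.
Proof.
move=> mA hA; elim: s => [|i s [m ih]].
  by rewrite big_nil mul0r pr0; split => //; exact: measurable0.
rewrite big_cons /= mulrSr mulrDl mul1r addrC; split; first exact: measurableU.
by apply: (le_trans (prU_le _ _)) => //; exact: lerD.
Qed.

End pr.

(** * Approximation of Borel sets and partitions by finitely many coordinates *)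

Section approximation.
Context {R : realType} (mu : probability fullX R).

Definition local_set n (B : set fullX) := forall x y, cyl x n y -> B x -> B y.

Lemma local_measurable n B : local_set n B -> measurable B.
Proof.
move=> h; apply: measurable_open; rewrite openE => x Bx.
by apply: filterS (nbhs_cyl x n) => y xy; exact: h Bx.
Qed.

Definition symdiff (A B : set fullX) := (A `\` B) `|` (B `\` A).

Lemma measurable_symdiff A B : measurable A -> measurable B -> measurable (symdiff A B).
Proof. by move=> mA mB; apply: measurableU; exact: measurableD. Qed.

Definition approximable (A : set fullX) := measurable A /\
  forall e : R, 0 < e -> exists n B, local_set n B /\ pr mu (symdiff A B) < e.

Lemma approximableU A B : approximable A -> approximable B -> approximable (A `|` B).
Proof.
move=> [mA hA] [mB hB]; split; first exact: measurableU.
move=> e e0; have e2 : 0 < e / 2 by rewrite divr_gt0.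
have [m [C [lC hC]]] := hA _ e2; have [n [D [lD hD]]] := hB _ e2.
exists (maxn m n), (C `|` D); split.
  by move=> x y xy [Cx|Dx]; [left|right];
    [apply: lC Cx|apply: lD Dx]; apply: cyl_le xy; rewrite ?leq_maxl ?leq_maxr.
have mC := local_measurable lC; have mD := local_measurable lD.
apply: (@le_lt_trans _ _ (pr mu (symdiff A C `|` symdiff B D))).
  apply: pr_le.
  - by apply: measurable_symdiff; exact: measurableU.
  - by apply: measurableU; exact: measurable_symdiff.
  - rewrite /symdiff => x /=; tauto.
apply: (le_lt_trans (prU_le _ _ _)); try exact: measurable_symdiff.
by rewrite [e]splitr ltrD.
Qed.

Lemma approximableC A : approximable A -> approximable (~` A).
Proof.
move=> [mA hA]; split; first exact: measurableC.
move=> e /hA[n [B [lB hB]]]; exists n, (~` B); split.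
  by move=> x y xy nBx By; apply: nBx; apply: lB By; exact: cyl_sym.
congr (_ < _) : hB; congr (pr mu _); apply/seteqP; rewrite /symdiff.
by split=> x /=; have := EM (B x); have := EM (A x); tauto.
Qed.

(** By continuity of the measure some finite union fills the whole union up to [e / 2], and that
    finite union is approximated up to [e / 2]. *)
Lemma approximable_bigcup (A : (set fullX)^nat) :
  (forall i, approximable (A i)) -> approximable (\bigcup_i A i).
Proof.
move=> hA.
have mA i : measurable (A i) by case: (hA i).
pose U n := \big[setU/set0]_(i < n.+1) A i.
have hU n : approximable (U n).
  elim: n => [|n ih]; rewrite /U big_ord_recr /=; last exact: approximableU.
  by rewrite big_ord0 set0U.
have mU n : measurable (U n) by case: (hU n).
have UE : \bigcup_i A i = \bigcup_n U n.
  by apply/esym; exact: (bigcup_bigsetU_bigcup A).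
have mb : measurable (\bigcup_n U n) by exact: bigcupT_measurable.
rewrite UE; split => // e e0; have e2 : 0 < e / 2 by rewrite divr_gt0.
have cv : (mu \o U) n @[n --> \oo] --> mu (\bigcup_n U n).
  apply: nondecreasing_cvg_mu => // m n mn; apply/subsetPset.
  exact: (subset_bigsetU (mn : (m.+1 <= n.+1)%N)).
have [n hn] : exists n, pr mu (\bigcup_n U n) - pr mu (U n) < e / 2.
  have cv' : pr mu (U n) @[n --> \oo] --> pr mu (\bigcup_n U n).
    by move: cv; rewrite prE// => /fine_cvgP[].
  have /cvgrPdist_lt /(_ _ e2) [n _ /(_ n (leqnn n))] := cv'.
  move=> /(le_lt_trans (ler_norm _)) h; by exists n.
have [m [B [lB hB]]] := (hU n).2 _ e2.
have mB := local_measurable lB.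
have sU : U n `<=` \bigcup_n U n by exact: bigcup_sup.
exists m, B; split => //.
apply: (@le_lt_trans _ _ (pr mu ((\bigcup_n U n `\` U n) `|` symdiff (U n) B))).
  apply: pr_le.
  - exact: measurable_symdiff.
  - by apply: measurableU; [exact: measurableD|exact: measurable_symdiff].
  - rewrite /symdiff => x /=; have := EM (U n x); have := @sU x; tauto.
apply: (le_lt_trans (prU_le _ _ _)); first exact: measurableD.
  exact: measurable_symdiff.
rewrite [e]splitr ltrD//; apply: le_lt_trans hn.
rewrite -lee_fin EFinB -!prE//; last exact: measurableD.
rewrite measureD//; last by rewrite -ge0_fin_numE// fin_num_measure.
by rewrite setIidr.
Qed.

(** The approximable sets form a sigma-algebra that contains the cylinders. *)
Lemma approximable_measurable A : measurable A -> approximable A.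
Proof.
rewrite fullX_measurableE; move: A; apply: smallest_sub.
  split.
  - split; first exact: measurable0.
    by move=> e e0; exists 0%N, set0; split => //; rewrite /symdiff setD0 setU0 pr0.
  - by move=> A hA; rewrite setTD; exact: approximableC.
  - exact: approximable_bigcup.
move=> A hA; have [n lA] : exists n, local_set n A.
  case: hA => [->|[x [n ->]]]; first by exists 0%N.
  by exists n => y z /cyl_eq yz /cyl_eq xy; rewrite xy yz.
split; first exact: local_measurable lA.
by move=> e e0; exists n, A; split => //; rewrite /symdiff setDv setU0 pr0.
Qed.

Lemma approximate_partition k (nm : fullX -> 'I_k) (e : R) :
  (forall i, measurable (nm @^-1` [set i])) -> 0 < e ->
  exists n (ka : fullX -> 'I_k),
    [/\ forall x y, cyl x n y -> ka y = ka x,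
        measurable [set x | nm x != ka x] & pr mu [set x | nm x != ka x] < e].
Proof.
move=> mnm e0.
have k0 : (0 < k)%N by apply: leq_ltn_trans (ltn_ord (nm (ext [::]))).
have ek : 0 < e / k.+1%:R by rewrite divr_gt0.
have h i : exists nB : nat * set fullX,
    local_set nB.1 nB.2 /\ pr mu (symdiff (nm @^-1` [set i]) nB.2) < e / k.+1%:R.
  by have [_ /(_ _ ek)[n [B hB]]] := approximable_measurable (mnm i); exists (n, B).
have [nB hnB] := choice h.
pose N := \max_(i < k) (nB i).1.
have lB i x y : cyl x N y -> (nB i).2 x <-> (nB i).2 y.
  move=> xy; have xy' : cyl x (nB i).1 y by apply: cyl_le xy; exact: leq_bigmax.
  by have [l _] := hnB i; split; apply: l => //; exact: cyl_sym.
(* The approximating sets may overlap and leave gaps, so an index is picked among those available,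
   with a fixed default in the gaps. A point where [nm] and [ka] differ still lies in one of the [k]
   symmetric differences; dividing [e] by [k.+1] keeps the final inequality strict. *)
pose ka x := if [pick i | `[< (nB i).2 x >]] is Some i then i else nm (ext [::]).
have kal x y : cyl x N y -> ka y = ka x.
  move=> xy; rewrite /ka; congr (if _ is Some i then i else _).
  by apply: eq_pick => i; apply/asboolP/asboolP => /(lB i _ _ xy).
have mka i : measurable (ka @^-1` [set i]).
  by apply: (@local_measurable N) => x y /kal /= ->.
have mne : measurable [set x | nm x != ka x].
  rewrite (_ : [set x | _] = \bigcup_(i in [set: 'I_k])
      (nm @^-1` [set i] `&` ~` (ka @^-1` [set i]))).
    apply: fin_bigcup_measurable => // i _; apply: measurableI => //.
    exact: measurableC.
  apply/seteqP; split=> x /=.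
    by move=> /eqP h1; exists (nm x) => //; split => // h2; apply: h1; rewrite -h2.
  by move=> [i _ [/= -> h1]]; apply/eqP => h2; apply: h1.
exists N, ka; split => //.
have ms i : measurable (symdiff (nm @^-1` [set i]) (nB i).2).
  by apply: measurable_symdiff => //; have [/local_measurable] := hnB i.
have hle i : pr mu (symdiff (nm @^-1` [set i]) (nB i).2) <= e / k.+1%:R.
  by apply: ltW; have [] := hnB i.
have [mb hb] := pr_bigU_le (enum 'I_k) ms hle.
apply: (@le_lt_trans _ _ (k%:R * (e / k.+1%:R))); last first.
  rewrite mulrA ltr_pdivrMr// mulrC ltr_pM2l// ltr_nat//.
rewrite size_enum_ord in hb; apply: le_trans hb; apply: pr_le => //.
move=> x /= hx; rewrite -bigcup_seq.
have [i hi] : exists i, symdiff (nm @^-1` [set i]) (nB i).2 x.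
  apply: contrapT => /forallNP hN; move/eqP: hx; apply; rewrite /ka.
  have hB i : (nB i).2 x <-> nm x = i.
    by have := hN i; rewrite /symdiff /=; have := EM ((nB i).2 x); have := EM (nm x = i); tauto.
  case: pickP => [i /asboolP /hB //|/(_ (nm x)) /asboolP h1].
  by exfalso; apply: h1; exact/hB.
by exists i => //=; rewrite mem_enum.
Qed.

End approximation.

(** * Words and products of weights along them *)

Section words.
Context {R : realType}.

Definition pcons (a : 'I_4) (y : fullX) : fullX :=
  fun i => if i is j.+1 then y j else a.

Lemma ext_cons a s : ext (a :: s) = pcons a (ext s).
Proof. by apply/funext => -[|i]. Qed.

Lemma iter_shiftE x i n : iter i full_shift x n = x (i + n)%N.
Proof. by elim: i n => //= i ih n; rewrite /full_shift ih addnS. Qed.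

Lemma cyl_iter x y i M n : cyl x n y -> (i + M <= n)%N ->
  cyl (iter i full_shift x) M (iter i full_shift y).
Proof.
move=> xy iM j jM; rewrite !iter_shiftE xy// (leq_trans _ iM)//.
by rewrite ltn_add2l.
Qed.

Definition wordt (x : fullX) n : n.-tuple 'I_4 := Tuple (introT eqP (size_word x n)).

Lemma wordtP x n (w : n.-tuple 'I_4) : wordt x n = w <-> cyl (ext w) n x.
Proof.
split=> [<-|h]; first exact/cyl_sym/cyl_word.
apply: val_inj => /=; apply: (@eq_from_nth _ ord0); rewrite size_word ?size_tuple//.
by move=> i lt; rewrite /word nth_mkseq// h.
Qed.

Lemma measurable_wordt n w : measurable ((wordt ^~ n) @^-1` [set w]).
Proof.
rewrite (_ : _ @^-1` _ = cyl (ext w) n); first exact: measurable_cyl.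
by apply/seteqP; split=> x /wordtP.
Qed.

Lemma sum_tuple_cons n (F : seq 'I_4 -> R) :
  \sum_(w : n.+1.-tuple 'I_4) F w = \sum_a \sum_(w : n.-tuple 'I_4) F (a :: w).
Proof.
rewrite pair_bigA /=.
rewrite (reindex (fun aw : 'I_4 * n.-tuple 'I_4 => [tuple of aw.1 :: aw.2])) //=.
exists (fun w : n.+1.-tuple 'I_4 => (thead w, [tuple of behead w])) => [[a w] _|w _] /=.
  by congr (_, _); apply: val_inj.
by rewrite [RHS]tuple_eta.
Qed.

Lemma sum_pair (I J : finType) (F : I * J -> R) :
  \sum_ij F ij = \sum_i \sum_j F (i, j).
Proof. by rewrite pair_bigA; apply: eq_bigr => -[]. Qed.

(** A g-function gives the preimages of each point weights of sum 1. The inequality admits the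
    conditional weights of a measure, which all vanish over a cylinder of mass 0. *)
Definition subnormalized (g : fullX -> R) :=
  (forall x, 0 <= g x) /\ forall y, \sum_a g (pcons a y) <= 1.

(** The first letter occurs in the first factor only, so summing over it removes that factor. The
    [M] letters left at the end are merely counted. *)
Lemma sum_word_weight g n M : subnormalized g ->
  \sum_(w : (n + M).-tuple 'I_4) \prod_(i < n) g (iter i full_shift (ext w))
    <= 4%:R ^+ M.
Proof.
move=> [g0 g1]; elim: n => [|n ih].
  under eq_bigr do rewrite big_ord0.
  by rewrite sumr_const card_tuple card_ord natrX.
rewrite (sum_tuple_cons _ (fun w => \prod_(i < n.+1) g (iter i full_shift (ext w)))).
rewrite exchange_big /=; apply: le_trans ih; apply: ler_sum => w _.
rewrite (eq_bigr (fun a => g (pcons a (ext w)) *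
    \prod_(i < n) g (iter i full_shift (ext w)))) => [|a _]; last first.
  rewrite big_ord_recl /= ext_cons; congr (_ * _); apply: eq_bigr => i _.
  by rewrite add0n -iterS iterSr.
rewrite -mulr_suml -[leRHS]mul1r; apply: ler_wpM2r => //.
by apply: prodr_ge0.
Qed.

End words.

(** * Gibbs' inequality for a partition and its finite-coordinate approximation *)

Section entropy_bound.
Context {R : realType} (mu : probability fullX R) (inv : invariant_measure full_shift mu).

Lemma measurable_iter_shift i : measurable_fun setT (iter i full_shift).
Proof.
elim: i => [|i ih]; first exact: measurable_id.
exact: (measurableT_comp measurable_shift ih).
Qed.

Lemma measurable_iter_preimage i A : measurable A ->
  measurable (iter i full_shift @^-1` A).
Proof. by move=> mA; rewrite -[X in measurable X]setTI; exact: measurable_iter_shift. Qed.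

Lemma invariant_iter i : invariant_measure (iter i full_shift) mu.
Proof.
elim: i => [|i ih] A mA //.
by rewrite -[RHS](inv mA) -[RHS]ih//; exact: (measurable_iter_preimage 1).
Qed.

Lemma int_iter i (F : fullX -> R) : bounded_measurable F ->
  \int[mu]_x F (iter i full_shift x) = \int[mu]_x F x.
Proof.
by apply: int_invariant; [exact: measurable_iter_shift|exact: invariant_iter].
Qed.

Definition local_fun (T : Type) n (F : fullX -> T) :=
  forall x y, cyl x n y -> F y = F x.

Lemma local_bmeas n (F : fullX -> R) : local_fun n F -> bounded_measurable F.
Proof. by move=> h; apply: continuous_bmeas; exact: cyl_continuous h. Qed.

(* This positivity lets a g-function vanish where the measure does. *)
Definition charged n (g : fullX -> R) :=
  forall x, 0 < pr mu (cyl x n) -> 0 < g x.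

Section fixed_partition.
(** [nm] is the name for the true partition and [ka] its approximation. [theta c d] is the weight
    given to the true name [c] when the approximate one is [d]; its logarithm measures the cost of
    the approximation. *)
Context k (nm ka : fullX -> 'I_k) (M : nat) (g : fullX -> R) (theta : 'I_k -> 'I_k -> R).
Context (mnm : forall i, measurable (nm @^-1` [set i])).
Context (lka : local_fun M ka) (lg : local_fun M g).
Context (sg : subnormalized g) (cg : charged M g).
Context (theta_gt0 : forall c d, 0 < theta c d).
Context (theta_sum : forall d, \sum_c theta c d <= 1).

Lemma measurable_ka i : measurable (ka @^-1` [set i]).
Proof. by apply: (@local_measurable M) => x y /lka /= ->. Qed.

Let S i := iter i full_shift.

Definition names n x : {ffun 'I_n -> 'I_k} := [ffun i : 'I_n => nm (S i x)].

(** The [M] extra letters make the values of [ka] and [g] at the first [n] shifts functions of the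
    word. *)
Let cell n x := (names n x, wordt x (n + M)).

Lemma measurable_names n c : measurable (names n @^-1` [set c]).
Proof.
rewrite (_ : _ @^-1` _ = \bigcap_(i in [set: 'I_n]) (S i @^-1` (nm @^-1` [set c i]))).
  apply: fin_bigcap_measurable => // i _; exact: measurable_iter_preimage.
apply/seteqP; split=> x /=.
  by move=> <- i _ /=; rewrite ffunE.
by move=> h; apply/ffunP => i; rewrite ffunE; exact: h.
Qed.

Let measurable_cell n cw : measurable (cell n @^-1` [set cw]).
Proof.
case: cw => c w.
rewrite (_ : _ @^-1` _ = (names n @^-1` [set c]) `&` ((wordt ^~ (n + M)) @^-1` [set w])).
  by apply: measurableI; [exact: measurable_names|exact: measurable_wordt].
by apply/seteqP; split=> x /=; [move=> [-> ->]|rewrite /cell => -[-> ->]].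
Qed.

Lemma bmeas_theta : bounded_measurable (fun x => ln (theta (nm x) (ka x))).
Proof.
apply: (bmeas_fin (k := fun x => (nm x, ka x)) (fun cd => ln (theta cd.1 cd.2))).
move=> [c d]; rewrite (_ : _ @^-1` _ = nm @^-1` [set c] `&` ka @^-1` [set d]).
  by apply: measurableI => //; exact: measurable_ka.
by apply/seteqP; split=> x /= [-> ->].
Qed.

Lemma bmeas_lng : bounded_measurable (fun x => ln (g x)).
Proof. by apply: (@local_bmeas M) => x y /lg ->. Qed.

(* Gibbs' inequality on the joint cells [(c, w)] of the names and of the words of
   length [n + M], against the weights [4^-M * prod_i theta (c i) _ * g _]. *)
Lemma join_entropy_le n :
  join_entropy full_shift mu (fun i => nm @^-1` [set i]) n <=
  M%:R * ln 4%:R +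
  n%:R * (- (\int[mu]_x ln (theta (nm x) (ka x))) - (\int[mu]_x ln (g x))).
Proof.
set I := ({ffun 'I_n -> 'I_k} * (n + M).-tuple 'I_4)%type.
pose p (cw : I) := pr mu (cell n @^-1` [set cw]).
pose th (cw : I) (i : 'I_n) := theta (cw.1 i) (ka (S i (ext cw.2))).
pose gg (cw : I) (i : 'I_n) := g (S i (ext cw.2)).
pose q (cw : I) := (4%:R ^+ M)^-1 * \prod_(i < n) (th cw i * gg cw i).
pose L (cw : I) := - (M%:R * ln 4%:R) + \sum_(i < n) (ln (th cw i) + ln (gg cw i)).
have [g0 g1] := sg.
have p0 cw : 0 <= p cw by exact: pr_ge0.
have q0 cw : 0 <= q cw.
  rewrite mulr_ge0 ?invr_ge0 ?exprn_ge0//; apply: prodr_ge0 => i _.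
  by apply: mulr_ge0; [exact/ltW/theta_gt0|exact: g0].
(* By invariance, the cylinder seen by [g] at time [i] has at least the mass of the cell, so
   [charged] applies. *)
have gg0 cw i : 0 < p cw -> 0 < gg cw i.
  move=> pcw; apply: cg; apply: (lt_le_trans pcw).
  have -> : pr mu (cyl (S i (ext cw.2)) M) =
      pr mu (S i @^-1` (cyl (S i (ext cw.2)) M)).
    by rewrite /pr invariant_iter//; exact: measurable_cyl.
  apply: pr_le; first exact: measurable_cell.
    by apply: measurable_iter_preimage; exact: measurable_cyl.
  move=> x /= <- /=; apply: (@cyl_iter _ _ _ _ (n + M)); last by rewrite leq_add2r ltnW.
  exact/cyl_sym/cyl_word.
have pL cw : p cw * ln (q cw) = p cw * L cw.
  have := p0 cw; rewrite le_eqVlt => /orP[/eqP <-|pcw]; first by rewrite !mul0r.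
  have h i : 0 < th cw i * gg cw i.
    by apply: mulr_gt0; [exact: theta_gt0|exact: gg0].
  have hp : 0 < \prod_(i < n) (th cw i * gg cw i) by apply: prodr_gt0.
  rewrite /q lnM ?posrE ?invr_gt0 ?exprn_gt0// lnV ?posrE ?exprn_gt0//.
  rewrite lnXn// /L mulr_natl ln_prod//; congr (_ * (_ + _)); apply: eq_bigr => i _.
  by rewrite lnM ?posrE ?gg0//; exact: theta_gt0.
have sp : \sum_cw p cw = 1.
  have := int_fin mu (fun=> 1) (@measurable_cell n); rewrite int_cst => ->.
  by apply: eq_bigr => cw _; rewrite mul1r.
have sq : \sum_cw q cw <= 1.
  rewrite -mulr_sumr -[leRHS](@mulVf _ (4%:R ^+ M)) ?expf_neq0//.
  rewrite ler_wpM2l ?invr_ge0 ?exprn_ge0//.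
  apply: le_trans (sum_word_weight n M sg).
  rewrite (sum_pair (fun cw : I => \prod_(i < n) (th cw i * gg cw i))) /=.
  rewrite exchange_big /=; apply: ler_sum => w _.
  (* For a fixed word the sum over all sequences of names factors into one sum of [theta] for each
     time. *)
  rewrite -(bigA_distr_bigA (fun (i : 'I_n) (c : 'I_k) => theta c (ka (S i (ext w))) * g (S i (ext w)))) /=.
  apply: ler_prod => i _; rewrite -mulr_suml; apply/andP; split.
    by rewrite mulr_ge0// sumr_ge0// => c _; exact: ltW.
  by rewrite -[leRHS]mul1r ler_wpM2r.
have namesE c : pr mu (names n @^-1` [set c]) = \sum_w p (c, w).
  transitivity (\sum_cw (cw.1 == c)%:R * p cw).
    rewrite -(int_fin mu (fun cw : I => (cw.1 == c)%:R) (@measurable_cell n)).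
    rewrite /pr -int_indic; last exact: measurable_names.
    apply: eq_Rintegral => x _ /=; rewrite indicE; congr ((nat_of_bool _)%:R).
    by apply/idP/eqP => [/set_mem|h]; [|exact/mem_set].
  rewrite (sum_pair (fun cw : I => (cw.1 == c)%:R * p cw)) /=.
  rewrite (bigD1 c)//= [X in _ + X]big1 => [|c' c'c]; last first.
    by rewrite big1// => w _; rewrite (negPf c'c) mul0r.
  by rewrite addr0; apply: eq_bigr => w _; rewrite eqxx mul1r.
(* Refining the names by the words can only increase the entropy. *)
apply: (@le_trans _ _ (\sum_cw - (p cw * ln (p cw)))).
  rewrite (sum_pair (fun cw : I => - (p cw * ln (p cw)))) /=.
  apply: ler_sum => c _.
  have -> : fine (mu (join_cell full_shift (fun i => nm @^-1` [set i]) c)) = \sum_w p (c, w).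
    rewrite -namesE; congr (fine (mu _)); apply/seteqP; split => x /=.
      by move=> h; apply/ffunP => i; rewrite ffunE; exact: h.
    by move=> <- i _ /=; rewrite ffunE.
  rewrite /entropy_fun mulr_suml -sumrN; apply: ler_sum => w _.
  rewrite lerN2; have := p0 (c, w).
  rewrite le_eqVlt => /orP[/eqP <-|pcw]; first by rewrite !mul0r.
  have h : p (c, w) <= \sum_w p (c, w).
    by rewrite (bigD1 w)//= lerDl sumr_ge0.
  by rewrite ler_pM2l// ler_ln ?posrE// (lt_le_trans pcw).
apply: (@le_trans _ _ (\sum_cw (- (p cw * L cw) + (q cw - p cw)))).
  apply: ler_sum => cw _; rewrite -pL.
  have pq : 0 < p cw -> 0 < q cw.
    move=> pcw; rewrite mulr_gt0 ?invr_gt0 ?exprn_gt0//; apply: prodr_gt0 => i _.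
    by apply: mulr_gt0; [exact: theta_gt0|exact: gg0].
  by have [] := gibbs (p0 cw) (q0 cw) pq.
rewrite big_split /= sumrB sp.
apply: (@le_trans _ _ (\sum_cw - (p cw * L cw))); first by rewrite gerDl subr_le0.
rewrite sumrN.
have -> : \sum_cw p cw * L cw = \int[mu]_x L (cell n x).
  by rewrite (int_fin mu L (@measurable_cell n)); apply: eq_bigr => cw _; rewrite mulrC.
have LE x : L (cell n x) = - (M%:R * ln 4%:R) +
    \sum_(i < n) (ln (theta (nm (S i x)) (ka (S i x))) + ln (g (S i x))).
  congr (_ + _); apply: eq_bigr => i _; rewrite /th /gg /= ffunE.
  have h : cyl (S i (ext (word x (n + M)))) M (S i x).
    apply: (@cyl_iter _ _ _ _ (n + M)); last by rewrite leq_add2r ltnW.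
    exact/cyl_sym/cyl_word.
  by rewrite (lka h) (lg h).
under eq_Rintegral do rewrite LE.
have bt i : bounded_measurable (fun x => ln (theta (nm (S i x)) (ka (S i x)))).
  by apply: (bmeas_comp (measurable_iter_shift i) bmeas_theta).
have bg i : bounded_measurable (fun x => ln (g (S i x))).
  by apply: (bmeas_comp (measurable_iter_shift i) bmeas_lng).
have bs (i : 'I_n) : bounded_measurable
    (fun x => ln (theta (nm (S i x)) (ka (S i x))) + ln (g (S i x))).
  exact: bmeasD.
rewrite intD; [|exact: bmeas_cst|exact: bmeas_sum].
rewrite int_cst int_sum// (eq_bigr (fun=> \int[mu]_x ln (theta (nm x) (ka x)) + \int[mu]_x ln (g x))).
  rewrite sumr_const card_ord -[_ *+ n]mulr_natl.
  by rewrite le_eqVlt; apply/orP; left; apply/eqP; ring.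
move=> i _; rewrite intD//; congr (_ + _).
  exact: (int_iter i bmeas_theta).
exact: (int_iter i bmeas_lng).
Qed.

End fixed_partition.
End entropy_bound.

(** * The bound for arbitrary partitions and for the entropy *)

Section entropy_le.
Context {R : realType} (mu : probability fullX R) (inv : invariant_measure full_shift mu).

Lemma partition_name k (P : 'I_k -> set fullX) : measurable_partition P ->
  exists nm : fullX -> 'I_k, P = fun i => nm @^-1` [set i].
Proof.
move=> [_ /trivIsetP tP cP].
have h x : exists i, P i x.
  have : (\bigcup_i P i) x by rewrite cP.
  by case=> i _ Pix; exists i.
have [nm hnm] := choice h.
exists nm; apply/funext => i; apply/seteqP; split=> x /=; last by move=> <-.
move=> Pix; apply: contrapT => /eqP ni.
by have := tP _ _ I I ni; apply/eqP/set0P; exists x.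
Qed.

Lemma charged_le m n (g : fullX -> R) : (m <= n)%N -> charged mu m g -> charged mu n g.
Proof.
move=> mn h x hx; apply: h; apply: lt_le_trans hx _.
by apply: pr_le; [exact: measurable_cyl|exact: measurable_cyl|exact: cyl_le].
Qed.

Lemma local_fun_le (T : Type) m n (F : fullX -> T) : (m <= n)%N ->
  local_fun m F -> local_fun n F.
Proof. by move=> mn h x y /(cyl_le mn); exact: h. Qed.

Lemma subnormalized_le1 (g : fullX -> R) x : subnormalized g -> g x <= 1.
Proof.
move=> [g0 g1]; apply: le_trans (g1 (full_shift x)).
rewrite (bigD1 (x 0%N))//= [X in g X <= _](_ : _ = pcons (x 0%N) (full_shift x)).
  by rewrite lerDl sumr_ge0.
by apply/funext => -[|i].
Qed.

Context (M : nat) (g : fullX -> R) (lg : local_fun M g)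
  (sg : subnormalized g) (cg : charged mu M g).

Lemma partition_entropy_le k (P : 'I_k -> set fullX) : measurable_partition P ->
  partition_entropy full_shift mu P <= - (\int[mu]_x ln (g x)).
Proof.
move=> mP; have [nm PE] := partition_name mP.
have mnm i : measurable (nm @^-1` [set i]).
  by case: mP => + _ _ => /(_ i); rewrite PE.
have A0 : 0 <= - (\int[mu]_x ln (g x)).
  rewrite oppr_ge0; have := int_cst mu 0 => <-; apply: int_le.
  - exact: bmeas_lng lg.
  - exact: bmeas_cst.
  - by move=> x; apply: ln_le0; exact: subnormalized_le1.
rewrite /partition_entropy.
set u := (fun n : nat => _).
(* A divergent [limn] takes the value [point = 0]. *)
have [cu|/dvgP ->] := pselect (cvgn u); last exact: A0.
apply/ler_addgt0Pr => de de0.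
have d4 : 0 < de / 4 by rewrite divr_gt0.
(* [theta] will put [1 - e] on the diagonal and [b] everywhere, of total at most 1 since
   [k * b <= e]. By the choice of [e], a correct guess costs at most [de / 4]. A wrong guess costs
   at most [- ln b] more, and [eta] bounds the measure of wrong guesses so that they contribute at
   most another [de / 4]. *)
pose e : R := 1 - expR (- (de / 4)).
have e0 : 0 < e by rewrite subr_gt0 expR_lt1 oppr_lt0.
have e1 : e < 1 by rewrite ltrBlDr ltrDl expR_gt0.
pose b : R := e / k.+1%:R.
have b0 : 0 < b by rewrite divr_gt0.
have b1 : b <= 1.
  by rewrite ler_pdivrMr// mul1r (le_trans (ltW e1))// ler1n.
have lnb : 0 <= - ln b by rewrite oppr_ge0 ln_le0.
pose eta := de / 4 / (1 - ln b).
have eta0 : 0 < eta by rewrite divr_gt0// ltr_pwDl.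
have [N [ka [lka mbad hbad]]] := approximate_partition mu mnm eta0.
pose theta (c d : 'I_k) : R := (if c == d then 1 - e else 0) + b.
have e1' : 0 < 1 - e by rewrite subr_gt0.
have theta0 c d : 0 < theta c d.
  by rewrite /theta; case: eqP => _; rewrite ?add0r// addr_gt0.
have theta1 d : \sum_c theta c d <= 1.
  rewrite big_split /= -big_mkcond big_pred1_eq sumr_const card_ord.
  have : b *+ k <= e by rewrite /b -[_ *+ k]mulr_natr -mulrA ger_pMr// mulrC ler_pdivrMr// mul1r ler_nat.
  lra.
pose K := maxn N M.
have lka' : local_fun K ka by apply: (local_fun_le (leq_maxl _ _)) => x y; exact: lka.
have lg' : local_fun K g by exact: (local_fun_le (leq_maxr _ _)).
have cg' : charged mu K g by exact: (charged_le (leq_maxr _ _)).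
have hth : - (\int[mu]_x ln (theta (nm x) (ka x))) <= de / 2.
  have bt := bmeas_theta theta mnm lka'.
  have bad := bmeas_indic (R := R) mbad.
  have -> : - (\int[mu]_x ln (theta (nm x) (ka x))) =
      \int[mu]_x (- 1 * ln (theta (nm x) (ka x))) by rewrite intZ// mulN1r.
  apply: (@le_trans _ _ (\int[mu]_x (de / 4 + (- ln b) * \1_[set x | nm x != ka x] x))).
    apply: int_le; first exact: bmeasZ.
      by apply: bmeasD; [exact: bmeas_cst|exact: bmeasZ].
    move=> x; rewrite mulN1r indicE.
    have -> : (x \in [set x | nm x != ka x]) = (nm x != ka x).
      by apply/idP/idP => [/set_mem|/mem_set].
    have lne : ln (1 - e) = - (de / 4) by rewrite /e subKr expRK.
    rewrite /theta; case: eqP => h /=.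
      by rewrite mulr0 addr0 lerNl -lne ler_ln ?posrE ?lerDl ?ltW// (addr_gt0 e1' b0).
    by rewrite add0r mulr1 lerDr ltW.
  rewrite intD; [|exact: bmeas_cst|exact: bmeasZ].
  rewrite int_cst intZ// int_indic//.
  apply: (@le_trans _ _ (de / 4 + de / 4)); last by lra.
  rewrite lerD2l; apply: (@le_trans _ _ (- ln b * eta)).
    by rewrite ler_wpM2l// ltW.
  by rewrite /eta mulrA ler_pdivrMr ?ltr_pwDl//; nra.
apply: limr_le => //.
(* The cost of the [K] surplus letters does not grow with [n], so it vanishes in the average. *)
have [n0 hn0] : exists n0 : nat, K%:R * ln 4%:R <= (de / 2) * n0%:R.
  exists (Num.bound (K%:R * ln 4%:R / (de / 2))).
  rewrite [leRHS]mulrC -ler_pdivrMr ?divr_gt0//; apply: ltW.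
  apply: archi_boundP; rewrite divr_ge0 ?mulr_ge0 ?ln_ge0 ?ler1n// ; exact: ltW.
exists n0.+1 => // n /= n0n.
have n_gt0 : 0 < n%:R :> R by rewrite ltr0n (leq_trans _ n0n).
rewrite /u ler_pdivrMr// PE; apply: le_trans (join_entropy_le inv mnm lka' lg' sg cg' theta0 theta1 n) _.
rewrite mulrC [_ * n%:R]mulrC.
set A := - (\int[mu]_x ln (g x)) in A0 *; set B := - (\int[mu]_x _) in hth *.
rewrite -/A.
have : K%:R * ln 4 <= de / 2 * n%:R :> R.
  apply: le_trans hn0 _; rewrite ler_pM2l ?divr_gt0// ler_nat.
  exact: leq_trans (leqnSn _) n0n.
have : n%:R * B <= n%:R * (de / 2) by rewrite ler_pM2l.
lra.
Qed.

Lemma entropy_le : (entropy full_shift mu <= (- (\int[mu]_x ln (g x)))%:E)%E.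
Proof.
apply: ub_ereal_sup => _ [k [P [mP ->]]].
by rewrite lee_fin; exact: partition_entropy_le.
Qed.

End entropy_le.

(** * Weak-star convergence *)

Section cylinder_measures.
Context {R : realType}.
Local Notation prob := (probability fullX R).
Implicit Types mu nu : prob.

Lemma pr_split mu (I : finType) (k : fullX -> I) (A : set fullX) :
  (forall i, measurable (k @^-1` [set i])) -> measurable A ->
  pr mu A = \sum_i pr mu (A `&` k @^-1` [set i]).
Proof.
move=> mk mA; rewrite /pr -int_indic//.
transitivity (\int[mu]_x (\sum_i \1_(A `&` k @^-1` [set i]) x : R)).
  apply: eq_Rintegral => x _; rewrite (bigD1 (k x))//= big1 ?addr0 => [|i ik].
    by rewrite !indicE; congr (nat_of_bool _)%:R; apply/idP/idP => /set_mem h;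
      apply/mem_set; [split|case: h].
  by rewrite indicE memNset// => -[_ /= kx]; rewrite kx eqxx in ik.
rewrite int_sum => [|i]; last by apply: bmeas_indic; exact: measurableI.
by apply: eq_bigr => i _; rewrite int_indic//; exact: measurableI.
Qed.

Lemma measurable_coord i a : measurable ((fun x : fullX => x i) @^-1` [set a]).
Proof.
by apply: (@local_measurable i.+1) => x y xy /= <-; exact: xy.
Qed.

Lemma preimage_shift_cyl a x n :
  full_shift @^-1` (cyl x n) `&` (fun x : fullX => x 0%N) @^-1` [set a] =
  cyl (pcons a x) n.+1.
Proof.
apply/seteqP; split=> y /=.
  by move=> [h1 h2] [|i] //; exact: h1.
by move=> h; split; [move=> i lt; exact: (h i.+1)|exact: (h 0%N)].
Qed.

Lemma pr_preimage_shift_cyl mu x n :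
  pr mu (full_shift @^-1` (cyl x n)) = \sum_a pr mu (cyl (pcons a x) n.+1).
Proof.
rewrite (pr_split mu (measurable_coord 0)).
  by apply: eq_bigr => a _; rewrite preimage_shift_cyl.
exact: (measurable_iter_preimage 1 (measurable_cyl x n)).
Qed.

Lemma prob_eq_pr_cyl mu nu : (forall x n, pr mu (cyl x n) = pr nu (cyl x n)) ->
  measure_eq mu nu.
Proof.
by move=> h; apply: prob_eq_cyl => x n; rewrite !prE ?h//; exact: measurable_cyl.
Qed.

(** The image of [mu] under the shift is a probability with the same values as [mu] on cylinders. *)
Lemma invariant_of_cyl mu :
  (forall x n, pr mu (cyl x n) = \sum_a pr mu (cyl (pcons a x) n.+1)) ->
  invariant_measure full_shift mu.
Proof.
move=> h.
pose nu_of : {measure set fullX -> \bar R} := pushforward mu full_shift.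
pose nu0 := nu_of measurable_shift.
have nu1 : nu0 setT = 1%E by exact: (probability_setT mu).
have [nu nuE] := prob_of_measureP nu1.
have nuE' A : pr nu A = pr mu (full_shift @^-1` A) by rewrite /pr nuE.
have munu : measure_eq nu mu.
  by apply: prob_eq_pr_cyl => x n; rewrite nuE' h pr_preimage_shift_cyl.
by move=> A mA; exact: etrans (esym (nuE A)) (munu A mA).
Qed.

Lemma cyl_ext_wordt x n : cyl (ext (wordt x n)) n = cyl x n.
Proof. by rewrite -(cyl_eq (@cyl_word x n)). Qed.

Lemma int_word mu n (F : fullX -> R) : local_fun n F ->
  \int[mu]_x F x = \sum_(w : n.-tuple 'I_4) F (ext w) * pr mu (cyl (ext w) n).
Proof.
move=> lF; transitivity (\int[mu]_x F (ext (wordt x n))).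
  by apply: eq_Rintegral => x _; apply/esym/lF; exact: cyl_word.
rewrite (int_fin mu (fun w : n.-tuple 'I_4 => F (ext w)) (@measurable_wordt n)).
apply: eq_bigr => w _; congr (_ * fine (mu _)).
by apply/seteqP; split=> x /wordtP.
Qed.

Lemma int_word_approx mu (psi : fullX -> R) n (e : R) : continuous psi ->
  (forall x y, cyl x n y -> `|psi y - psi x| < e) ->
  `|\int[mu]_x psi x - \sum_(w : n.-tuple 'I_4) psi (ext w) * pr mu (cyl (ext w) n)| <= e.
Proof.
move=> cpsi h; pose F x := psi (ext (wordt x n)).
have wordt_eq x y : cyl x n y -> wordt y n = wordt x n.
  by move=> xy; apply/wordtP; apply: cyl_sym; rewrite -(cyl_eq xy); exact: cyl_word.
have lF : local_fun n F by move=> x y xy; rewrite /F (wordt_eq _ _ xy).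
have wordtK (w : n.-tuple 'I_4) : wordt (ext w) n = w by apply/wordtP.
have -> : \sum_(w : n.-tuple 'I_4) psi (ext w) * pr mu (cyl (ext w) n) = \int[mu]_x F x.
  by rewrite (int_word mu lF); apply: eq_bigr => w _; rewrite /F wordtK.
have bpsi := continuous_bmeas cpsi; have bF := local_bmeas lF.
have hF x : `|psi x - F x| < e by rewrite distrC; apply: h; exact: cyl_word.
have le_ae G H : bounded_measurable G -> bounded_measurable H ->
    (forall x, G x <= H x + e) -> \int[mu]_x G x <= \int[mu]_x H x + e.
  move=> bG bH GH; have := int_cst mu e; set c := (X in X = e) => ce.
  rewrite -[X in _ + X]ce /c -intD//; last exact: bmeas_cst.
  by apply: int_le => //; apply: bmeasD => //; exact: bmeas_cst.
rewrite ler_distl lerBlDr; apply/andP; split.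
  by apply: le_ae => // x; have := hF x; rewrite ltr_norml; lra.
by apply: le_ae => // x; have := hF x; rewrite ltr_norml; lra.
Qed.

(** A continuous function is uniformly close to one depending on [n] letters, with an error that is
    the same for all measures; the integral of the latter is a finite combination of cylinder
    masses. *)
Lemma weak_star_of_cyl (mus : nat -> prob) mu :
  (forall x n, pr (mus k) (cyl x n) @[k --> \oo] --> pr mu (cyl x n)) ->
  weak_star_cvg mus mu.
Proof.
move=> h psi cpsi; apply/cvgrPdist_lt => e e0.
have e4 : 0 < e / 4 by rewrite divr_gt0.
have [n hn] := uniform_cyl cpsi e4.
pose Sn m := \sum_(w : n.-tuple 'I_4) psi (ext w) * pr m (cyl (ext w) n).
have cS : Sn (mus k) @[k --> \oo] --> Sn mu.
  by apply: cvg_big => [|w _]; [exact: add_continuous|apply: cvgM; [exact: cvg_cst|exact: h]].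
have /cvgrPdist_lt /(_ _ e4) := cS.
apply: filterS => k hk.
have h1 := int_word_approx mu cpsi hn.
have h2 := int_word_approx (mus k) cpsi hn.
move: hk h1 h2; rewrite -/(Sn mu) -/(Sn (mus k)) !ltr_norml !ler_norml; lra.
Qed.

(** The indicator function of a cylinder is continuous. *)
Lemma weak_star_cyl (mus : nat -> prob) mu x n : weak_star_cvg mus mu ->
  pr (mus k) (cyl x n) @[k --> \oo] --> pr mu (cyl x n).
Proof.
move=> h.
have c1 : continuous (\1_(cyl x n) : fullX -> R).
  apply: (@cyl_continuous _ _ n) => y z yz.
  rewrite !indicE; congr (nat_of_bool _)%:R.
  by apply/idP/idP => /set_mem xy; apply/mem_set => i lt; rewrite -xy// yz.
have := h _ c1; rewrite int_indic; last exact: measurable_cyl.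
by under eq_fun do (rewrite int_indic; last exact: measurable_cyl).
Qed.

End cylinder_measures.

(** * Markov measures as equilibrium states *)

Section markov.
Context {R : realType}.
Local Notation prob := (probability fullX R).
Implicit Types (e : R) (x y : fullX).

(** The matrix is symmetric, so the uniform vector is stationary and the transition probabilities
    forwards in time also serve as the g-function. For [e = 0] it is the identity. *)
Definition trans e (a b : 'I_4) : R := (if a == b then 1 else e) / (1 + 3 * e).

Definition gfun e x : R := trans e (x 0%N) (x 1%N).

(* The mass of [cyl x n] for the Markov measure; [e = expR (- t)] gives the
   equilibrium state of [t * phi1], and [e = 0] the ground state. *)
Definition weight e x n : R :=
  if n is k.+1 then 4^-1 * \prod_(i < k) gfun e (iter i full_shift x) else 1.

Lemma denom_gt0 e : 0 <= e -> 0 < 1 + 3 * e. Proof. by move=> e0; lra. Qed.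

Lemma transC e a b : trans e a b = trans e b a.
Proof. by rewrite /trans eq_sym. Qed.

Lemma trans_ge0 e a b : 0 <= e -> 0 <= trans e a b.
Proof.
by move=> e0; apply: divr_ge0; [case: eqP|exact/ltW/denom_gt0].
Qed.

Lemma trans_gt0 e a b : 0 < e -> 0 < trans e a b.
Proof.
by move=> e0; apply: divr_gt0; [case: eqP|exact/denom_gt0/ltW].
Qed.

(** The constant vector gives the normalization; the letter masses of an unknown measure will give
    the equation that determines them. *)
Lemma trans_sum e (c : 'I_4 -> R) b : 0 <= e ->
  \sum_a trans e a b * c a = (c b + e * (\sum_a c a - c b)) / (1 + 3 * e).
Proof.
move=> e0; rewrite (bigD1 b)//= [in RHS](bigD1 b)//= {1}/trans eqxx.
set S := \sum_(i | _) c i; have -> : c b + S - c b = S by ring.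
rewrite [RHS]mulrDl; congr (_ + _); first by rewrite mul1r mulrC.
rewrite mulrAC mulr_sumr; apply: eq_bigr => a /negPf ab.
by rewrite /trans ab.
Qed.

Lemma trans_sum1 e b : 0 <= e -> \sum_a trans e a b = 1.
Proof.
move=> e0; have := trans_sum (fun=> 1) b e0.
under eq_bigr do rewrite mulr1.
move=> ->; rewrite sumr_const card_ord.
have -> : 1 + e * (1 *+ 4 - 1) = 1 + 3 * e :> R by rewrite -[_ *+ 4]mulr_natr; ring.
by rewrite divff// gt_eqF// denom_gt0.
Qed.

Lemma gfun_local e : local_fun 2 (gfun e).
Proof. by move=> x y xy; rewrite /gfun !xy. Qed.

Lemma gfun_subnormalized e : 0 <= e -> subnormalized (gfun e).
Proof.
move=> e0; split=> [x|y]; first exact: trans_ge0.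
by rewrite /gfun /= trans_sum1.
Qed.

Lemma weight_local e n : local_fun n (weight e ^~ n).
Proof.
case: n => // n x y xy; rewrite /weight; congr (_ * _); apply: eq_bigr => i _.
by apply: gfun_local; apply: (cyl_iter xy); rewrite addn2 ltnS.
Qed.

Lemma weight_pcons e a x n :
  weight e (pcons a x) n.+2 = gfun e (pcons a x) * weight e x n.+1.
Proof.
rewrite /weight mulrCA; congr (_ * _); rewrite big_ord_recl /=; congr (_ * _).
by apply: eq_bigr => i _; rewrite add0n -iterS iterSr.
Qed.

Lemma markov_exists e : 0 <= e ->
  exists nu : prob, forall x n, pr nu (cyl x n) = weight e x n.
Proof.
move=> e0.
have [||s|nu hnu] := @kolmogorov R (fun s => weight e (ext s) (size s)).
- case=> //= a s; rewrite mulr_ge0 ?invr_ge0//; apply: prodr_ge0 => i _.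
  by case: (gfun_subnormalized e0).
- by [].
- under eq_bigr do rewrite size_rcons.
  have extl a : cyl (ext s) (size s) (ext (rcons s a)).
    by move=> i lt; rewrite /ext nth_rcons lt.
  case: (lastP s) extl => [|s' b] extl.
    under eq_bigr do rewrite /= big_ord0 mulr1.
    by rewrite sumr_const card_ord -[_ *+ 4]mulr_natr mulVf.
  set s'' := rcons s' b in extl *.
  have sz : size s'' = (size s').+1 by rewrite size_rcons.
  rewrite sz in extl *; rewrite /weight.
  under eq_bigr do rewrite big_ord_recr mulrA.
  rewrite (eq_bigr (fun a => weight e (ext s'') (size s').+1 * trans e b a)).
    rewrite -mulr_sumr [X in _ = _ * X](eq_bigr (fun a => trans e a b)).
      by rewrite trans_sum1 ?mulr1.
    by move=> a _; rewrite transC.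
  move=> a _; congr (_ * _); first exact: (@weight_local e _ _ _ (extl a)).
  rewrite /gfun !iter_shiftE addn0 addn1 /ext !nth_rcons size_rcons ltnn eqxx.
  by rewrite ltnS leqnn ltnn eqxx.
exists nu => x n; rewrite /pr hnu /=.
rewrite size_word; apply: weight_local; exact: cyl_word.
Qed.

Section fixed_eps.
Context e (e0 : 0 <= e) (nu : prob) (nuE : forall x n, pr nu (cyl x n) = weight e x n).

Lemma markov_invariant : invariant_measure full_shift nu.
Proof.
apply: invariant_of_cyl => x [|n].
  rewrite nuE /=; under eq_bigr do rewrite nuE /= big_ord0 mulr1.
  by rewrite sumr_const card_ord -[_ *+ 4]mulr_natr mulVf.
rewrite nuE; under eq_bigr do rewrite nuE weight_pcons.
by rewrite -mulr_suml /gfun /= trans_sum1 ?mul1r.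
Qed.

End fixed_eps.

Section positive_eps.
Context e (e0 : 0 < e) (nu : prob) (nuE : forall x n, pr nu (cyl x n) = weight e x n).

Lemma gfun_gt0 x : 0 < gfun e x. Proof. exact: trans_gt0. Qed.

Lemma entropy_le_gfun (mu : prob) : invariant_measure full_shift mu ->
  (entropy full_shift mu <= (- (\int[mu]_x ln (gfun e x)))%:E)%E.
Proof.
move=> inv; apply: (@entropy_le _ _ inv 2); first exact: gfun_local.
  exact/gfun_subnormalized/ltW.
by move=> x _; exact: gfun_gt0.
Qed.

(** For the partition by the first letter the join cells are cylinders, so the join entropy is the
    integral of minus the logarithm of [weight]. By invariance it is affine in the length: [ln 4]
    for the first letter, then the same amount for each transition. *)
Lemma entropy_markov :
  ((- (\int[nu]_x ln (gfun e x)))%:E <= entropy full_shift nu)%E.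
Proof.
have inv := markov_invariant (ltW e0) nuE.
pose P (i : 'I_4) := (fun x : fullX => x 0%N) @^-1` [set i].
have mP : measurable_partition P.
  split; first by move=> i; exact: measurable_coord.
    by apply/trivIsetP => i j _ _ ij; apply/seteqP; split => // x [xi xj]; move: ij; rewrite -[i]xi -[j]xj eqxx.
  by apply/seteqP; split=> // x _; exists (x 0%N).
apply: ereal_sup_ge; exists (partition_entropy full_shift nu P)%:E; first by exists 4%N, P.
rewrite lee_fin.
set A := - _.
have bg : bounded_measurable (fun x => ln (gfun e x)) by exact: bmeas_lng (@gfun_local e).
have joinE n : join_entropy full_shift nu P n.+1 = ln 4 + n%:R * A.
  pose w (c : {ffun 'I_n.+1 -> 'I_4}) : fullX := fun i => c (inord i).
  have mnm i : measurable ((fun x : fullX => x 0%N) @^-1` [set i]) by exact: measurable_coord.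
  transitivity (\int[nu]_x (- ln (weight e (w (names (fun x : fullX => x 0%N) n.+1 x)) n.+1))).
    rewrite (int_fin nu (fun c => - ln (weight e (w c) n.+1)) (measurable_names mnm (n := n.+1))).
    apply: eq_bigr => c _.
    have -> : join_cell full_shift P c = cyl (w c) n.+1.
      apply/seteqP; split=> x /=.
        move=> h i lt; have := h (Ordinal lt) I; rewrite /P /= iter_shiftE addn0 => ->.
        by rewrite /w; congr (c _); apply: val_inj; rewrite /= inordK.
      by move=> h i _; rewrite /P /= iter_shiftE addn0 h// /w inord_val.
    have -> : names (fun x : fullX => x 0%N) n.+1 @^-1` [set c] = cyl (w c) n.+1.
      apply/seteqP; split=> x /=.
        by move=> <- i lt; rewrite /w ffunE iter_shiftE addn0 inordK.
      by move=> h; apply/ffunP => i; rewrite ffunE iter_shiftE addn0 h// /w inord_val.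
    by rewrite /entropy_fun -/(pr nu _) nuE mulNr mulrC.
  transitivity (\int[nu]_x (ln 4 + \sum_(i < n) (- 1) * ln (gfun e (iter i full_shift x)))); last first.
    have bgi i : bounded_measurable (fun x => ln (gfun e (iter i full_shift x))).
      by apply: (bmeas_comp (measurable_iter_shift i) bg).
    rewrite intD; [|exact: bmeas_cst|apply: bmeas_sum => i; exact: bmeasZ].
    rewrite int_cst int_sum => [|i]; last exact: bmeasZ.
    congr (_ + _); rewrite (eq_bigr (fun=> A)) => [|i _].
      by rewrite sumr_const card_ord mulr_natl.
    by rewrite intZ// (int_iter inv i bg) mulN1r.
  apply: eq_Rintegral => x _.
  have -> : weight e (w (names (fun x : fullX => x 0%N) n.+1 x)) n.+1 = weight e x n.+1.
    apply: weight_local => i lt.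
    by rewrite /w ffunE iter_shiftE addn0 inordK.
  rewrite /weight lnM ?posrE ?prodr_gt0//; last by move=> i _; exact: gfun_gt0.
  rewrite lnV ?posrE// opprD opprK; congr (_ + _).
  rewrite ln_prod => [|i]; last exact: gfun_gt0.
  by rewrite -sumrN; apply: eq_bigr => i _; rewrite mulN1r.
suff cA : (fun n => join_entropy full_shift nu P n / n%:R) @ \oo --> A.
  by rewrite /partition_entropy (cvg_lim _ cA).
rewrite -cvg_shiftS.
rewrite (_ : (fun n => _) = fun n => A + (ln 4 - A) * harmonic n).
  have : (fun n => A + (ln 4 - A) * harmonic n) @ \oo --> A + (ln 4 - A) * 0.
    apply: cvgD; first exact: cvg_cst.
    by apply: cvgM; [exact: cvg_cst|exact: cvg_harmonic].
  by rewrite mulr0 addr0.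
apply/funext => n /=; rewrite joinE /harmonic /=.
have n0 : n.+1%:R != 0 :> R by rewrite pnatr_eq0.
apply: (mulIf n0); rewrite divfK// mulrDl -mulrA mulVf// mulr1 -natr1; ring.
Qed.

End positive_eps.

End markov.

(** * Uniqueness of the measure attaining the entropy bound *)

Section uniqueness.
Context {R : realType}.
Local Notation prob := (probability fullX R).
Context (e : R) (e0 : 0 < e) (mu : prob) (inv : invariant_measure full_shift mu).

Lemma cyl_shift x n y : cyl x n.+1 y -> cyl (full_shift x) n (full_shift y).
Proof. by move=> xy i lt; exact: xy. Qed.

Lemma pr_cyl_shift_le x n : pr mu (cyl x n.+1) <= pr mu (cyl (full_shift x) n).
Proof.
have -> : pr mu (cyl (full_shift x) n) = pr mu (full_shift @^-1` cyl (full_shift x) n).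
  by rewrite /pr inv//; exact: measurable_cyl.
apply: pr_le; first exact: measurable_cyl.
  exact: (measurable_iter_preimage 1 (measurable_cyl _ _)).
by move=> y /cyl_shift.
Qed.

(** The conditional probability of the first letter given the next [n] letters, equal to 0 where the
    condition has mass 0 because division by 0 yields 0. *)
Definition cond_weight n x : R := pr mu (cyl x n.+1) / pr mu (cyl (full_shift x) n).

Lemma cond_weight_local n : local_fun n.+1 (cond_weight n).
Proof.
move=> x y xy; rewrite /cond_weight (cyl_eq xy); congr (_ / pr mu _).
by apply/esym/cyl_eq/cyl_shift.
Qed.

Lemma cond_weight_subnormalized n : subnormalized (cond_weight n).
Proof.
split=> [x|y]; first by rewrite divr_ge0// pr_ge0.
rewrite (eq_bigr (fun a => pr mu (cyl (pcons a y) n.+1) / pr mu (cyl y n)))//.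
rewrite -mulr_suml -pr_preimage_shift_cyl.
have -> : pr mu (full_shift @^-1` cyl y n) = pr mu (cyl y n).
  by rewrite /pr inv//; exact: measurable_cyl.
have [->|h] := eqVneq (pr mu (cyl y n)) 0; first by rewrite mul0r.
by rewrite divff.
Qed.

Lemma cond_weight_charged n : charged mu n.+1 (cond_weight n).
Proof.
by move=> x h; rewrite divr_gt0// (lt_le_trans h)// pr_cyl_shift_le.
Qed.

Lemma sum_pr_cyl n : \sum_(w : n.-tuple 'I_4) pr mu (cyl (ext w) n) = 1.
Proof.
rewrite -(int_cst mu 1) (@int_word _ mu n (fun=> 1))//.
by apply: eq_bigr => w _; rewrite mul1r.
Qed.

Context (max : ((- (\int[mu]_x ln (gfun e x)))%:E <= entropy full_shift mu)%E).

(* The equality case of Gibbs' inequality, applied to [cond_weight]. *)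
Lemma maximizing_cyl n x :
  pr mu (cyl x n.+2) = gfun e x * pr mu (cyl (full_shift x) n.+1).
Proof.
set N := n.+1.
pose p (w : N.+1.-tuple 'I_4) := pr mu (cyl (ext w) N.+1).
pose q (w : N.+1.-tuple 'I_4) := gfun e (ext w) * pr mu (cyl (full_shift (ext w)) N).
have hle : - (\int[mu]_x ln (gfun e x)) <= - (\int[mu]_x ln (cond_weight N x)).
  rewrite -lee_fin; apply: le_trans max _.
  apply: (entropy_le inv); [exact: cond_weight_local|
    exact: cond_weight_subnormalized|exact: cond_weight_charged].
have p0 w : 0 <= p w by exact: pr_ge0.
have q0 w : 0 <= q w by rewrite mulr_ge0 ?pr_ge0// ltW// gfun_gt0.
have pq w : 0 < p w -> 0 < pr mu (cyl (full_shift (ext w)) N).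
  by move=> h; apply: (lt_le_trans h); exact: pr_cyl_shift_le.
have pq' w : 0 < p w -> 0 < q w by move=> /pq h; rewrite mulr_gt0 ?gfun_gt0.
have sq : \sum_w q w = 1.
  rewrite (sum_tuple_cons _ (fun s => gfun e (ext s) * pr mu (cyl (full_shift (ext s)) N))).
  rewrite exchange_big /= -[RHS](sum_pr_cyl N); apply: eq_bigr => w _.
  rewrite (eq_bigr (fun a => gfun e (pcons a (ext w)) * pr mu (cyl (ext w) N))).
    by rewrite -mulr_suml /gfun /= trans_sum1 ?mul1r// ltW.
  by move=> a _; rewrite ext_cons.
have lg : local_fun N.+1 (fun x => ln (gfun e x)).
  by move=> y z yz; congr ln; apply: (@gfun_local _ e); exact: cyl_le yz.
have lc : local_fun N.+1 (fun x => ln (cond_weight N x)).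
  by move=> y z yz; congr ln; exact: cond_weight_local.
(* The defect in Gibbs' inequality. The defects are nonnegative and add up to the integral of
   [ln (cond_weight N x)] minus that of [ln (gfun e x)], which [hle] makes nonpositive; hence all of
   them vanish. *)
pose D w := (- (p w * ln (q w)) + (q w - p w)) - (- (p w * ln (p w))).
have D0 w : 0 <= D w by rewrite subr_ge0; case: (gibbs (p0 w) (q0 w) (@pq' w)).
have DE w : D w = (q w - p w) + (ln (cond_weight N (ext w)) * p w - ln (gfun e (ext w)) * p w).
  rewrite /D; have := p0 w; rewrite le_eqVlt => /orP[/eqP h|h].
    by rewrite -h !mul0r !mulr0; ring.
  have -> : ln (q w) = ln (gfun e (ext w)) + ln (pr mu (cyl (full_shift (ext w)) N)).
    by rewrite /q lnM ?posrE ?gfun_gt0 ?pq.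
  have -> : ln (cond_weight N (ext w)) = ln (p w) - ln (pr mu (cyl (full_shift (ext w)) N)).
    by rewrite /cond_weight ln_div ?posrE ?pq.
  ring.
have sD : \sum_w D w = 0.
  apply/eqP; rewrite eq_le sumr_ge0 ?andbT => [|w _]//.
  rewrite (eq_bigr _ (fun w _ => DE w)) big_split /= !sumrB sq sum_pr_cyl subrr add0r.
  have -> : \sum_(w : N.+1.-tuple 'I_4) ln (cond_weight N (ext w)) * p w = \int[mu]_x ln (cond_weight N x).
    exact: esym (int_word mu lc).
  have -> : \sum_(w : N.+1.-tuple 'I_4) ln (gfun e (ext w)) * p w = \int[mu]_x ln (gfun e x).
    exact: esym (int_word mu lg).
  by move: hle; lra.
have pqE w : p w = q w.
  have := psumr_eq0P (fun w _ => D0 w) sD => /(_ w isT) /eqP; rewrite subr_eq0.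
  rewrite eq_sym; case: (gibbs (p0 w) (q0 w) (@pq' w)) => _ ->.
  by move/eqP.
have := pqE (wordt x N.+1); rewrite /p /q cyl_ext_wordt => ->.
congr (_ * pr mu _).
by apply/esym/cyl_eq/cyl_shift/cyl_word.
Qed.

(** Splitting by the second letter shows that the vector of letter masses is stationary for
    [trans e]; as [e] is positive, only the uniform vector is. *)
Lemma maximizing_letter x : pr mu (cyl x 1) = 4^-1.
Proof.
pose c (a : 'I_4) := pr mu (cyl (ext [:: a]) 1).
have cE y : pr mu (cyl y 1) = c (y 0%N).
  by congr (pr mu _); apply/cyl_eq => -[|].
have sc : \sum_a c a = 1.
  rewrite -[RHS](sum_pr_cyl 1) (sum_tuple_cons _ (fun s => pr mu (cyl (ext s) 1))).
  by apply: eq_bigr => a _; rewrite (big_pred1 [tuple])// => w; apply/esym/eqP; exact: tuple0.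
have key a : c a = (c a + e * (1 - c a)) / (1 + 3 * e).
  have := trans_sum c a (ltW e0); rewrite sc => <-; rewrite {1}/c.
  rewrite (pr_split mu (measurable_coord 1) (measurable_cyl _ _)).
  apply: eq_bigr => b _; rewrite transC.
  have := maximizing_cyl 0 (ext [:: a; b]); rewrite cE /gfun /= => <-.
  congr (pr mu _); apply/seteqP; split=> y /=.
    by move=> [h1 h2] [|[|]]//= _; exact: (h1 0%N).
  by move=> h; split; [move=> [|]//= _; exact: (h 0%N)|exact: (h 1%N)].
rewrite cE; set a := x 0%N.
have d0 : 1 + 3 * e != 0 by rewrite gt_eqF// denom_gt0 ?ltW.
have : c a * (1 + 3 * e) = c a + e * (1 - c a) by rewrite {1}key divfK.
move=> h; have {}h : e * (4 * c a - 1) = 0 by move: h; lra.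
move/eqP: h; rewrite mulf_eq0 gt_eqF//= subr_eq0 => /eqP h.
by apply: (mulfI (_ : 4 != 0 :> R)) => //; rewrite h divff.
Qed.

Lemma maximizing_weight x n : pr mu (cyl x n) = weight e x n.
Proof.
elim: n x => [|[|n] ih] x.
- rewrite /weight -(prT mu); congr (pr mu _).
  by apply/seteqP; split.
- by rewrite maximizing_letter /= big_ord0 mulr1.
rewrite maximizing_cyl ih.
have xE : x = pcons (x 0%N) (full_shift x) by apply/funext => -[|].
by rewrite [RHS](congr1 (weight e ^~ n.+2) xE) weight_pcons.
Qed.

End uniqueness.

(** * Equilibrium states in the direction of the face *)

Section equilibrium.
Context {R : realType}.
Local Notation prob := (probability fullX R).

Definition phi1 (x : fullX) : R := if x 0%N == x 1%N then 0 else -1.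

Lemma phi1_continuous : continuous phi1.
Proof. by apply: (@cyl_continuous _ _ 2) => x y xy; rewrite /phi1 !xy. Qed.

(** The constant is the pressure of the potential: the entropy bound by this g-function says that no
    free energy exceeds it. *)
Lemma ln_gfun t x : ln (gfun (expR (- t)) x) = t * phi1 x - ln (1 + 3 * expR (- t)).
Proof.
have d0 : 0 < 1 + 3 * expR (- t) by rewrite denom_gt0 ?expR_ge0.
rewrite /gfun /trans ln_div ?posrE//; last by case: eqP; rewrite ?expR_gt0.
congr (_ - _); rewrite /phi1; case: eqP => _; first by rewrite ln1 mulr0.
by rewrite expRK mulrN1.
Qed.

Lemma int_ln_gfun (mu : prob) t : \int[mu]_x ln (gfun (expR (- t)) x) =
  (\int[mu]_x (t * phi1 x)) - ln (1 + 3 * expR (- t)).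
Proof.
under eq_Rintegral do rewrite ln_gfun.
rewrite intD ?int_cst//; last exact: bmeas_cst.
by apply: bmeasZ; exact: continuous_bmeas phi1_continuous.
Qed.

Lemma ES_phi1 t (nu : prob) :
  (forall x n, pr nu (cyl x n) = weight (expR (- t)) x n) ->
  ES (fun x => t * phi1 x) nu.
Proof.
move=> nuE; have inv := markov_invariant (expR_ge0 _) nuE.
split => // mu invmu; rewrite /free_energy.
have h1 := entropy_le_gfun (expR_gt0 (- t)) invmu.
have h2 := entropy_markov (expR_gt0 (- t)) nuE.
rewrite int_ln_gfun in h1; rewrite int_ln_gfun in h2.
apply: (le_trans (leeD2r _ h1)); apply: le_trans (leeD2r _ h2).
by rewrite -!EFinD lee_fin; lra.
Qed.

Lemma ES_phi1_weight t (mu : prob) : ES (fun x => t * phi1 x) mu ->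
  forall x n, pr mu (cyl x n) = weight (expR (- t)) x n.
Proof.
move=> [inv maxmu]; apply: maximizing_weight => //; first exact: expR_gt0.
have [nu nuE] := markov_exists (expR_ge0 (- t)).
have invnu := markov_invariant (expR_ge0 _) nuE.
have h2 := entropy_markov (expR_gt0 (- t)) nuE.
have := maxmu nu invnu; rewrite /free_energy => h.
have := le_trans (leeD2r _ h2) h.
rewrite !int_ln_gfun; case: (entropy full_shift mu) => [r| |] //=.
  by rewrite -!EFinD !lee_fin; lra.
by move=> _; exact: leey.
Qed.

End equilibrium.

(** * The zero-temperature limit *)

Section ground_state.
Context {R : realType}.
Local Notation prob := (probability fullX R).

Definition const_seq (a : 'I_4) : fullX := fun=> a.

Lemma int_dirac (x : fullX) (F : fullX -> R) : bounded_measurable F ->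
  \int[\d_x]_y F y = F x.
Proof.
move=> [mF _]; rewrite /Rintegral integral_dirac//; last exact/measurable_EFinP.
by rewrite diracT mul1e.
Qed.

Lemma orbit_measure n (z : 'I_n -> fullX) : (0 < n)%N ->
  exists mu : prob,
    (forall A, mu A = \sum_i (n%:R^-1)%:E * \d_(z i) A)%E /\
    forall F, bounded_measurable F -> \int[mu]_x F x = n%:R^-1 * \sum_i F (z i).
Proof.
move=> n0.
have [||mu [muE muI]] := @mixture_exists _ fullX R n (fun=> n%:R^-1) (fun i => \d_(z i)).
- by move=> _; rewrite invr_ge0.
- by rewrite sumr_const card_ord -[_ *+ n]mulr_natr mulVf// pnatr_eq0 -lt0n.
exists mu; split=> // F bF; rewrite muI// mulr_sumr; apply: eq_bigr => i _.
by congr (_ * _); exact: int_dirac.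
Qed.

(** For [e = 0] a nonempty word has weight [4^-1] if it is constant and 0 otherwise. *)
Lemma fixed_points_measure : exists mu : prob,
  [/\ (forall A, mu A = \sum_(a < 4) (4^-1)%:E * \d_(const_seq a) A)%E,
      forall F, bounded_measurable F -> \int[mu]_x F x = 4^-1 * \sum_a F (const_seq a),
      invariant_measure full_shift mu &
      forall x n, pr mu (cyl x n) = weight 0 x n].
Proof.
have [mu [muE muI]] := @orbit_measure 4 const_seq isT.
exists mu; split => //.
  by move=> A mA; rewrite !muE; apply: eq_bigr => a _.
have c_ind x n : pr mu (cyl x n) = 4^-1 * \sum_a \1_(cyl x n) (const_seq a).
  rewrite /pr -int_indic; last exact: measurable_cyl.
  by rewrite muI//; apply: bmeas_indic; exact: measurable_cyl.
move=> x n; elim: n x => [|[|n] ih] x.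
- by rewrite (_ : cyl x 0 = setT) ?prT//; apply/seteqP; split.
- rewrite c_ind /= big_ord0; congr (_ * _); rewrite (bigD1 (x 0%N))//= big1 ?addr0.
    by rewrite indicE mem_set// => -[].
  by move=> a ax; rewrite indicE memNset// => /(_ 0%N isT) /= e; rewrite -e eqxx in ax.
have -> : weight 0 x n.+2 = gfun 0 x * weight 0 (full_shift x) n.+1 :> R.
  have xE : x = pcons (x 0%N) (full_shift x) by apply/funext => -[|].
  by rewrite (congr1 (weight 0 ^~ n.+2) xE) weight_pcons -xE.
rewrite -ih !c_ind mulrCA; congr (_ * _); rewrite mulr_sumr; apply: eq_bigr => a _.
have -> : gfun 0 x = (x 0%N == x 1%N)%:R :> R.
  by rewrite /gfun /trans mulr0 addr0 divr1; case: eqP.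
rewrite !indicE -natrM mulnb; congr (nat_of_bool _)%:R.
apply/idP/andP => [/set_mem h|[/eqP h0 /set_mem h]].
  split; first by rewrite -(h 0%N)// -(h 1%N).
  by apply/mem_set => i lt; rewrite /full_shift -h.
apply/mem_set => -[|i] lt; last exact: (h i).
by rewrite h0; exact: (h 0%N).
Qed.

Lemma weight_cvg (t : nat -> R) x n : t k @[k --> \oo] --> +oo ->
  weight (expR (- t k)) x n @[k --> \oo] --> weight 0 x n.
Proof.
move=> tinf.
have e0 : expR (- t k) @[k --> \oo] --> (0 : R).
  exact: (cvg_comp _ _ tinf (@cvgr_expR R)).
case: n => [|n]; first exact: cvg_cst.
rewrite /weight; apply: cvgM; first exact: cvg_cst.
apply: cvg_big => [|i _]; first exact: mul_continuous.
rewrite /gfun /trans; apply: cvgM.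
  by case: eqP => _; [exact: cvg_cst|exact: e0].
apply: cvgV; first by rewrite mulr0 addr0.
apply: cvgD; first exact: cvg_cst.
by apply: cvgM; [exact: cvg_cst|exact: e0].
Qed.

(** Each equilibrium state has prescribed cylinder masses, so the limit does not depend on the
    sequence of parameters. The integers serve as parameters for the converse. *)
Lemma ground_states_phi1 (mu : prob) : (forall x n, pr mu (cyl x n) = weight 0 x n) ->
  is_singleton_measure (ground_states phi1) mu.
Proof.
move=> muE nu; split=> [[inv [t [mus [_ tinf mES mcvg]]]]|h].
  apply: prob_eq_pr_cyl => x n; rewrite muE.
  have c1 := weak_star_cyl (x := x) (n := n) mcvg.
  have c2 := weight_cvg (x := x) (n := n) tinf.
  have E : (fun k => pr (mus k) (cyl x n)) = fun k => weight (expR (- t k)) x n.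
    by apply/funext => k; exact: (ES_phi1_weight (mES k)).
  by apply: (cvg_unique _ c1); rewrite // E.
have nuE x n : pr nu (cyl x n) = weight 0 x n.
  by rewrite -muE /pr h//; exact: measurable_cyl.
split; first exact: (markov_invariant (lexx 0) nuE).
have [mus hmus] := choice (fun k : nat => markov_exists (expR_ge0 (- (k%:R : R)))).
exists (fun k => k%:R), mus; split.
- by move=> m n; rewrite ler_nat.
- exact: cvgr_idn.
- by move=> k; apply: ES_phi1; exact: hmus.
- apply: weak_star_of_cyl => x n; rewrite nuE.
  under eq_fun do rewrite hmus.
  exact: (weight_cvg (@cvgr_idn R)).
Qed.

End ground_state.

(** * Ground states maximize the integral *)

Section ground_states_maximize.
Context {R : realType}.
Local Notation prob := (probability fullX R).

Lemma entropy_le_ln4 (mu : prob) : invariant_measure full_shift mu ->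
  (entropy full_shift mu <= (ln 4)%:E)%E.
Proof.
move=> inv.
have := @entropy_le _ _ inv 0 (fun=> 4^-1).
rewrite int_cst lnV ?posrE// opprK; apply => //.
  split=> [x|y]; first by rewrite invr_ge0.
  by rewrite sumr_const card_ord -[_ *+ 4]mulr_natr mulVf.
Qed.

Lemma entropy_ge0 (mu : prob) : (0 <= entropy full_shift mu)%E.
Proof.
pose P (i : 'I_1) : set fullX := setT.
have mP : measurable_partition P.
  split; first by move=> i; exact: measurableT.
    by apply/trivIsetP => i j _ _; rewrite !ord1.
  by apply/seteqP; split => // x _; exists ord0.
apply: ereal_sup_ge; exists (partition_entropy full_shift mu P)%:E; first by exists 1%N, P.
rewrite lee_fin /partition_entropy.
suff -> : (fun n => join_entropy full_shift mu P n / n%:R) = fun=> 0 by rewrite lim_cst.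
apply/funext => n; rewrite /join_entropy big1 ?mul0r// => w _.
rewrite (_ : join_cell _ _ _ = setT); last by apply/seteqP; split.
by rewrite probability_setT /entropy_fun ln1 mulr0 oppr0.
Qed.

(** As entropy lies between 0 and [ln 4], an equilibrium state at a parameter [t > 0] misses the
    integral of [phi] against any invariant measure by at most [ln 4 / t]. *)
Lemma ground_states_max (phi : fullX -> R) (nu eta : prob) : continuous phi ->
  ground_states phi nu -> invariant_measure full_shift eta ->
  \int[eta]_x phi x <= \int[nu]_x phi x.
Proof.
move=> cphi [_ [t [mus [_ tinf mES mcvg]]]] inveta.
have bphi := continuous_bmeas cphi.
have h k : t k * (\int[eta]_x phi x - (\int[mus k]_x phi x)) <= ln 4.
  have [invm /(_ eta inveta)] := mES k; rewrite /free_energy !intZ// => h1.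
  have h2 := le_trans h1 (leeD2r _ (entropy_le_ln4 invm)).
  have := le_trans (leeD2r _ (entropy_ge0 eta)) h2.
  by rewrite -!EFinD lee_fin; lra.
rewrite leNgt; apply/negP => lt.
pose de := ((\int[eta]_x phi x) - (\int[nu]_x phi x)) / 2.
have de0 : 0 < de by rewrite divr_gt0// subr_gt0.
have /cvgrPdist_lt /(_ _ de0) ev1 := mcvg phi cphi.
have ev2 : \forall k \near \oo, ln 4 / de + 1 < t k.
  by move/cvgryPgt : tinf; exact.
have [k [/= h1 h2]] := filter_ex (filterI ev1 ev2).
have ln40 : 0 <= ln 4 :> R by rewrite ln_ge0// ler1n.
have tk : 0 < t k by apply: lt_trans h2; rewrite ltr_wpDl// divr_ge0// ltW.
have h3 : t k * de <= ln 4.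
  apply: le_trans (h k); rewrite ler_pM2l//.
  by move: h1; rewrite /de ltr_norml; lra.
have : ln 4 < t k * de.
  by rewrite -ltr_pdivrMr//; apply: lt_trans h2; rewrite ltrDl.
by rewrite ltNge h3.
Qed.

End ground_states_maximize.

(** * The potential and its rotation set *)

Section potential.
Context {R : realType}.
Local Notation prob := (probability fullX R).
Implicit Types x y : fullX.

(* The inverse of the length of the initial run of [x], and [0] on a fixed point. *)
Definition inv_run x : R :=
  if pselect (exists n, x n.+1 != x 0%N) is left h then (ex_minn h).+1%:R^-1 else 0.

Lemma inv_run_ge0 x : 0 <= inv_run x.
Proof. by rewrite /inv_run; case: pselect => // h; rewrite invr_ge0. Qed.

Lemma inv_run_le x n : (forall i, (i <= n)%N -> x i = x 0%N) -> inv_run x <= n.+1%:R^-1.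
Proof.
move=> h; rewrite /inv_run; case: pselect => [ex|_]; last by rewrite invr_ge0.
case: ex_minnP => m xm _; rewrite lef_pV2 ?posrE// ler_nat ltnS leqNgt.
by apply/negP => /h xm'; rewrite xm' eqxx in xm.
Qed.

Lemma inv_run_eq x n : (forall i, (i <= n)%N -> x i = x 0%N) -> x n.+1 != x 0%N ->
  inv_run x = n.+1%:R^-1.
Proof.
move=> h xn; rewrite /inv_run; case: pselect => [ex|[]]; last by exists n.
case: ex_minnP => m xm mmin; congr (_.+1%:R^-1); apply/eqP.
rewrite eqn_leq mmin//= leqNgt; apply/negP => /h xm'.
by rewrite xm' eqxx in xm.
Qed.

Lemma first_change x n : (forall i, (i <= n)%N -> x i = x 0%N) \/
  exists2 j, (j < n)%N & (forall i, (i <= j)%N -> x i = x 0%N) /\ x j.+1 != x 0%N.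
Proof.
elim: n => [|n [ih|[j jn hj]]]; first by left; case.
  have [h|h] := eqVneq (x n.+1) (x 0%N); last by right; exists n.
  by left=> i; rewrite leq_eqVlt => /orP[/eqP ->//|]; exact: ih.
by right; exists j => //; exact: leq_trans jn _.
Qed.

(** Either the common letters contain the end of the run and the values agree, or both values lie
    between 0 and [1 / (n + 1)]. *)
Lemma inv_run_cyl x y n : cyl x n.+1 y -> `|inv_run y - inv_run x| <= n.+1%:R^-1.
Proof.
move=> xy; have [h|[j jn [h1 h2]]] := first_change x n.
  have hy i : (i <= n)%N -> y i = y 0%N by move=> le; rewrite !xy// h.
  have := inv_run_le h; have := inv_run_le hy.
  have := inv_run_ge0 x; have := inv_run_ge0 y; rewrite ler_norml.
  by set c := _^-1; lra.
rewrite (inv_run_eq h1 h2) (@inv_run_eq y j) ?subrr ?normr0 ?invr_ge0//.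
  by move=> i ij; rewrite !xy ?h1// (leq_ltn_trans ij)// ltnS ltnW.
by rewrite !xy.
Qed.

Definition letter_sign (a : 'I_4) : R := if (a < 2)%N then 1 else -1.

(** The summand 1 gives the face its length: on the fixed points [inv_run] vanishes and the sign
    alone remains. *)
Definition phi2 x : R := letter_sign (x 0%N) * (1 + inv_run x).

Lemma norm_letter_sign a : `|letter_sign a| = 1.
Proof. by rewrite /letter_sign; case: ifP; rewrite ?normrN normr1. Qed.

Lemma phi2_continuous : continuous phi2.
Proof.
move=> x U /nbhs_ballP[e /= e0 eU].
have [n hn] : exists n : nat, n.+1%:R^-1 < e.
  exists (Num.bound e^-1); rewrite invf_plt ?posrE//.
  apply: (lt_trans (archi_boundP _)); first by rewrite invr_ge0 ltW.
  by rewrite ltr_nat.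
apply: filterS (nbhs_cyl x n.+1) => y xy; apply: eU.
rewrite /ball /= /phi2 xy// -mulrBr normrM norm_letter_sign mul1r.
rewrite distrC opprD addrACA subrr add0r.
exact: le_lt_trans (inv_run_cyl xy) hn.
Qed.

Definition slope n : R := \sum_(j < n.+1) (j.+1%:R^-1 - n.+2%:R^-1).

(* The chord through the points of abscissas [1 / (n + 1)] and [1 / (n + 2)] of the
   graph of [1 / k |-> harm k / k]; see [line_vertex] and [line_vertexS]. *)
Definition line n (s : R) : R := n.+2%:R^-1 + slope n * s.

Lemma slope_coef_ge0 n (j : 'I_n.+1) : 0 <= j.+1%:R^-1 - n.+2%:R^-1 :> R.
Proof. by rewrite subr_ge0 lef_pV2 ?posrE// ler_nat ltnS ltnW. Qed.

(** If the initial run has length [j + 1] with [j <= n], the letter changes at time [j] and that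
    term of the sum raises [1 / (n + 2)] to [1 / (j + 1)]; a longer run is covered by the
    constant. *)
Lemma phi2_le x n : `|phi2 x| <= 1 + n.+2%:R^-1 +
  \sum_(j < n.+1) (j.+1%:R^-1 - n.+2%:R^-1) * - phi1 (iter j full_shift x).
Proof.
have phi1_le0 y : 0 <= - phi1 y :> R by rewrite /phi1; case: eqP; rewrite ?oppr0// opprK.
rewrite /phi2 normrM norm_letter_sign mul1r ger0_norm ?addr_ge0 ?inv_run_ge0//.
rewrite -addrA lerD2l.
have [h|[j jn [h1 h2]]] := first_change x n.+1.
  apply: (le_trans (inv_run_le h)); rewrite lerDl sumr_ge0// => j _.
  by rewrite mulr_ge0// slope_coef_ge0.
rewrite (inv_run_eq h1 h2) (bigD1 (Ordinal jn))//= {1}/phi1 !iter_shiftE addn0 addn1.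
rewrite h1// eq_sym (negPf h2) opprK mulr1 addrA [_ + (_ - _)]addrC subrK lerDl.
by apply: sumr_ge0 => i _; rewrite mulr_ge0// slope_coef_ge0.
Qed.

Lemma bmeas_phi1 : bounded_measurable (phi1 : fullX -> R).
Proof. exact: continuous_bmeas phi1_continuous. Qed.

Lemma bmeas_phi2 : bounded_measurable phi2.
Proof. exact: continuous_bmeas phi2_continuous. Qed.

(** Under an invariant measure all shifts of [phi1] have the same integral, so the coefficients of
    the pointwise bound add up to [slope n]. *)
Lemma int_phi2_le (mu : prob) n : invariant_measure full_shift mu ->
  `|\int[mu]_x phi2 x| <= 1 + line n (- \int[mu]_x phi1 x).
Proof.
move=> inv.
have bp j : bounded_measurable (fun x => (- (j.+1%:R^-1 - n.+2%:R^-1)) * phi1 (iter j full_shift x) : R).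
  by apply: bmeasZ; apply: (bmeas_comp (measurable_iter_shift j) bmeas_phi1).
pose B x : R := 1 + n.+2%:R^-1 +
  \sum_(j < n.+1) (- (j.+1%:R^-1 - n.+2%:R^-1)) * phi1 (iter j full_shift x).
have bB : bounded_measurable B.
  by apply: bmeasD; [exact: bmeas_cst|apply: bmeas_sum => j; exact: bp].
have BE : \int[mu]_x B x = 1 + line n (- \int[mu]_x phi1 x).
  rewrite /B intD; [|exact: bmeas_cst|by apply: bmeas_sum => j; exact: bp].
  rewrite int_cst int_sum => [|j]; last exact: bp.
  rewrite /line addrA; congr (_ + _); rewrite /slope mulr_suml; apply: eq_bigr => j _.
  rewrite intZ; last by apply: (bmeas_comp (measurable_iter_shift j) bmeas_phi1).
  by rewrite (int_iter inv j bmeas_phi1) mulNr mulrN.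
have hB x : `|phi2 x| <= B x.
  apply: le_trans (phi2_le x n) _; rewrite /B lerD2l; apply: ler_sum => j _.
  by rewrite mulNr mulrN.
rewrite -BE ler_norml -mulN1r -intZ//; apply/andP; split; apply: int_le => //.
- exact: bmeasZ.
- exact: bmeas_phi2.
- by move=> x; have := hB x; rewrite ler_norml mulN1r => /andP[].
- exact: bmeas_phi2.
- by move=> x; have := hB x; rewrite ler_norml => /andP[].
Qed.

Definition harm n : R := \sum_(i < n) i.+1%:R^-1.

Definition sgb (b : bool) : R := if b then -1 else 1.

Section periodic.
Context (b : bool) (n : nat).

Definition block_letter (q : nat) : 'I_4 := inord (b.*2 + odd q).

(** Blocks have length [n.+1], and [b] selects the class of letters between which they alternate. *)
Definition periodic_seq : fullX := fun i => block_letter (i %/ n.+1).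

Lemma block_letter_sign q : letter_sign (block_letter q) = sgb b.
Proof.
rewrite /letter_sign /block_letter inordK; last by case: b; case: (odd q).
by case: b; case: (odd q).
Qed.

Lemma block_letterS q : block_letter q.+1 != block_letter q.
Proof.
rewrite /block_letter -val_eqE /= !inordK /=; first by case: b; case: (odd q).
all: by case: b; case: (odd q).
Qed.

Lemma periodic_seqE q i : (i <= n)%N -> periodic_seq (q * n.+1 + i)%N = block_letter q.
Proof. by move=> le; rewrite /periodic_seq divnMDl// divn_small// addn0. Qed.

Lemma periodic_seq_phi1 q i : (i <= n)%N ->
  phi1 (iter (q * n.+1 + i) full_shift periodic_seq) = - (i == n)%:R :> R.
Proof.
move=> le; rewrite /phi1 !iter_shiftE addn0 periodic_seqE//.
have [->|ne] := eqVneq i n.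
  have -> : (q * n.+1 + n + 1 = q.+1 * n.+1 + 0)%N by lia.
  by rewrite periodic_seqE// eq_sym (negPf (block_letterS q)).
by rewrite -addnA addn1 periodic_seqE ?eqxx ?oppr0// ltn_neqAle ne.
Qed.

Lemma periodic_seq_phi2 q i : (i <= n)%N ->
  phi2 (iter (q * n.+1 + i) full_shift periodic_seq) =
  sgb b * (1 + (n - i).+1%:R^-1).
Proof.
move=> le; rewrite /phi2 !iter_shiftE addn0 periodic_seqE// block_letter_sign.
congr (_ * (_ + _)); apply: inv_run_eq.
  move=> j jn; rewrite !iter_shiftE addn0 -addnA !periodic_seqE//; lia.
rewrite !iter_shiftE addn0 periodic_seqE//.
have -> : (q * n.+1 + i + (n - i).+1 = q.+1 * n.+1 + 0)%N by lia.
by rewrite periodic_seqE// block_letterS.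
Qed.

(** Along a block the remaining run takes the lengths [n + 1] down to 1, whose inverses sum to
    [harm n.+1], and the letter changes once. The orbit consists of two blocks, with equal
    contributions. *)
Lemma periodic_measure : exists mu : prob,
  [/\ invariant_measure full_shift mu,
      \int[mu]_x phi1 x = - n.+1%:R^-1 &
      \int[mu]_x phi2 x = sgb b * (1 + harm n.+1 / n.+1%:R)].
Proof.
pose z (k : 'I_(n.+1 + n.+1)) := iter k full_shift periodic_seq.
have [//|mu [muE muI]] := @orbit_measure R _ z.
have period : iter (n.+1 + n.+1) full_shift periodic_seq = periodic_seq.
  apply/funext => i; rewrite iter_shiftE /periodic_seq addnn -mul2n divnMDl//.
  by rewrite /block_letter add2n /= negbK.
have sumE (F : fullX -> R) (v : nat -> R) :
    (forall q i, (i <= n)%N -> F (iter (q * n.+1 + i) full_shift periodic_seq) = v i) ->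
    bounded_measurable F ->
    \int[mu]_x F x = (\sum_(i < n.+1) v i) / n.+1%:R.
  move=> Fv bF; rewrite muI// big_split_ord /=.
  rewrite [X in X + _](eq_bigr (fun i : 'I_n.+1 => v i)) => [|i _]; last first.
    by have := Fv 0%N i; rewrite mul0n add0n; apply; rewrite -ltnS.
  rewrite [X in _ + X](eq_bigr (fun i : 'I_n.+1 => v i)) => [|i _]; last first.
    by have := Fv 1%N i; rewrite mul1n; apply; rewrite -ltnS.
  have n0 : n.+1%:R != 0 :> R by rewrite pnatr_eq0.
  rewrite natrD; move: (n.+1%:R) n0 => a a0.
  have a2 : a + a != 0 by rewrite -mulr2n mulrn_eq0.
  by apply: (mulfI a2); rewrite mulrA divff// mul1r mulrDl mulrCA divff// mulr1.
exists mu; split.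
- move=> A mA; rewrite !muE big_ord_recr [RHS]big_ord_recl /= addeC; congr (_ + _)%E.
    by rewrite [z ord0](_ : _ = full_shift (z ord_max))// -[LHS]period.
- rewrite (sumE _ (fun i => - (i == n)%:R)); last 2 first.
    by move=> q i le; exact: periodic_seq_phi1.
    exact: bmeas_phi1.
  rewrite big_ord_recr /= big1 ?add0r ?eqxx ?mulN1r//.
  by move=> i _; rewrite (ltn_eqF (ltn_ord i)) oppr0.
- rewrite (sumE _ (fun i => sgb b * (1 + (n - i).+1%:R^-1))); last 2 first.
    by move=> q i le; exact: periodic_seq_phi2.
    exact: bmeas_phi2.
  rewrite -mulr_sumr big_split /= sumr_const card_ord.
  rewrite (reindex_inj rev_ord_inj) /=.
  rewrite (eq_bigr (fun i : 'I_n.+1 => i.+1%:R^-1)) => [|i _]; last first.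
    by rewrite subSS subKn// -ltnS.
  have n0 : n.+1%:R != 0 :> R by rewrite pnatr_eq0.
  by rewrite -/(harm n.+1) -mulrA mulrDl divff.
Qed.

End periodic.

End potential.

Lemma continuous_lincomb (R : realType) (T : topologicalType) (f g : T -> R) (a b : R) :
  continuous f -> continuous g -> continuous (fun x => a * f x + b * g x).
Proof.
by move=> cf cg x; apply: cvgD; apply: cvgM; [exact: cvg_cst|exact: cf|exact: cvg_cst|exact: cg].
Qed.

(** * The rotation set as a region cut out by lines *)

Section rotation_set.
Context {R : realType}.
Local Notation prob := (probability fullX R).
Implicit Types u v w : 'rV[R]_2.

Definition pt (a c : R) : 'rV[R]_2 := \row_i (if i == 0 then a else c).

Lemma pt0 a c : pt a c 0 0 = a. Proof. by rewrite mxE. Qed.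

Lemma pt1 a c : pt a c 0 1 = c. Proof. by rewrite mxE. Qed.

Lemma forall_ord2 (P : 'I_2 -> Prop) : P 0 -> P 1 -> forall j, P j.
Proof.
move=> P0 P1 [[|[|]]//= i2].
  by rewrite (_ : Ordinal i2 = 0)//; exact: val_inj.
by rewrite (_ : Ordinal i2 = 1)//; exact: val_inj.
Qed.

Lemma vec2P u v : u 0 0 = v 0 0 -> u 0 1 = v 0 1 -> u = v.
Proof.
by move=> h0 h1; apply/rowP; apply: forall_ord2.
Qed.

Lemma dotE u v : dot u v = u 0 0 * v 0 0 + u 0 1 * v 0 1.
Proof. by rewrite /dot big_ord_recl big_ord1; congr (_ + _ * _); congr (_ _ _); exact: val_inj. Qed.

Definition Phi x : 'rV[R]_2 := pt (phi1 x) (phi2 x).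

Lemma Phi_continuous : continuous Phi.
Proof.
move=> x U [P hP sPU].
have h0 : nbhs x ((phi1 : fullX -> R) @^-1` P 0 0).
  by apply: phi1_continuous; have := hP 0 0; rewrite /Phi pt0.
have h1 : nbhs x ((phi2 : fullX -> R) @^-1` P 0 1).
  by apply: phi2_continuous; have := hP 0 1; rewrite /Phi pt1.
apply: filterS (filterI h0 h1) => y [/= y0 y1]; apply: sPU => i j.
by rewrite ord1; move: j; apply: forall_ord2; rewrite ?pt0 ?pt1.
Qed.

Lemma rvE (mu : prob) : rv Phi mu = pt (\int[mu]_x phi1 x) (\int[mu]_x phi2 x).
Proof.
by apply: vec2P; rewrite ?pt0 ?pt1 mxE; apply: eq_Rintegral => x _; rewrite ?pt0 ?pt1.
Qed.

Lemma dot_Phi u x : dot u (Phi x) = u 0 0 * phi1 x + u 0 1 * phi2 x.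
Proof. by rewrite dotE pt0 pt1. Qed.

Lemma dot_Phi_continuous u : continuous (fun x => dot u (Phi x)).
Proof.
rewrite (_ : (fun x => _) = fun x => u 0 0 * phi1 x + u 0 1 * phi2 x).
  by apply: continuous_lincomb; [exact: phi1_continuous|exact: phi2_continuous].
by apply/funext => x; exact: dot_Phi.
Qed.

Lemma dot_rv u (mu : prob) : dot u (rv Phi mu) = \int[mu]_x dot u (Phi x).
Proof.
under eq_Rintegral do rewrite dot_Phi.
rewrite rvE dotE pt0 pt1 intD ?intZ//; try exact: bmeas_phi1; try exact: bmeas_phi2.
  by apply: bmeasZ; exact: bmeas_phi1.
by apply: bmeasZ; exact: bmeas_phi2.
Qed.

Lemma mix0 u v (t : R) : ((1 - t) *: u + t *: v) 0 0 = (1 - t) * u 0 0 + t * v 0 0.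
Proof. by rewrite !mxE. Qed.

Lemma mix1 u v (t : R) : ((1 - t) *: u + t *: v) 0 1 = (1 - t) * u 0 1 + t * v 0 1.
Proof. by rewrite !mxE. Qed.

Lemma Rot_mix u v (t : R) : Rot Phi u -> Rot Phi v -> 0 <= t <= 1 ->
  Rot Phi ((1 - t) *: u + t *: v).
Proof.
move=> [mu imu <-] [nu inu <-] /andP[t0 t1].
pose w (i : 'I_2) := if i == 0 then 1 - t else t.
have [||m [mE mI]] := @mixture_exists _ fullX R 2 w (fun i => if i == 0 then mu else nu).
- by move=> i; rewrite /w; case: eqP => _ //; rewrite subr_ge0.
- by rewrite big_ord_recl big_ord1 /w /= subrK.
exists m.
  move=> A mA; rewrite !mE; apply: eq_bigr => i _; congr (_ * _)%E.
  by case: eqP => _; [exact: imu|exact: inu].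
have mE2 F : bounded_measurable F ->
    \int[m]_x F x = (1 - t) * (\int[mu]_x F x) + t * (\int[nu]_x F x).
  by move=> bF; rewrite mI// big_ord_recl big_ord1.
rewrite !rvE; apply: vec2P; rewrite ?mix0 ?mix1 ?pt0 ?pt1.
  by rewrite mE2//; exact: bmeas_phi1.
by rewrite mE2//; exact: bmeas_phi2.
Qed.

Definition region : set 'rV[R]_2 :=
  [set u | -1 <= u 0 0 <= 0 /\ forall n, `|u 0 1| <= 1 + line n (- u 0 0)].

Lemma Rot_region u : Rot Phi u -> region u.
Proof.
move=> [mu inv <-]; rewrite rvE; split; rewrite ?pt0 ?pt1; last first.
  by move=> n; exact: int_phi2_le.
have c0 := bmeas_cst fullX (0 : R); have c1 := bmeas_cst fullX (-1 : R).
have lo : -1 <= \int[mu]_x phi1 x.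
  rewrite -(int_cst mu (-1)); apply: int_le => //; first exact: bmeas_phi1.
  by move=> x; rewrite /phi1; case: eqP.
have hi : \int[mu]_x phi1 x <= 0.
  rewrite -(int_cst mu 0); apply: int_le => //; first exact: bmeas_phi1.
  by move=> x; rewrite /phi1; case: eqP.
by rewrite lo hi.
Qed.

Definition vertex b n := pt (- n.+1%:R^-1) (sgb b * (1 + harm n.+1 / n.+1%:R)).

Definition apex b := pt 0 (sgb b).

Lemma Rot_vertex b n : Rot Phi (vertex b n).
Proof.
by have [mu [inv h1 h2]] := @periodic_measure R b n; exists mu => //; rewrite rvE h1 h2.
Qed.

Lemma phi2_const a : phi2 (const_seq a) = letter_sign a :> R.
Proof.
rewrite /phi2 (_ : inv_run _ = 0) ?addr0 ?mulr1//.
by rewrite /inv_run; case: pselect => // -[n]; rewrite eqxx.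
Qed.

Lemma Rot_apex b : Rot Phi (apex b).
Proof.
pose z (i : 'I_1) := const_seq (block_letter b 0).
have [//|mu [muE muI]] := @orbit_measure R 1 z.
exists mu; first by move=> A mA; rewrite !muE.
rewrite rvE !muI; [|exact: bmeas_phi2|exact: bmeas_phi1].
rewrite !big_ord1 invr1 !mul1r; apply: vec2P; rewrite ?pt0 ?pt1.
  by rewrite /phi1 eqxx.
by rewrite phi2_const block_letter_sign.
Qed.

Lemma slopeE n : slope n = harm n.+1 - n.+1%:R / n.+2%:R :> R.
Proof. by rewrite /slope sumrB sumr_const card_ord -[_ *+ n.+1]mulr_natl. Qed.

Lemma harmS n : harm n.+1 = harm n + n.+1%:R^-1 :> R.
Proof. by rewrite /harm big_ord_recr. Qed.

Lemma natr_neq0 n : n.+1%:R != 0 :> R. Proof. by rewrite pnatr_eq0. Qed.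

Lemma line_vertex n : line n n.+1%:R^-1 = harm n.+1 / n.+1%:R :> R.
Proof.
rewrite /line slopeE; have := natr_neq0 n; have := natr_neq0 n.+1.
set h := harm _; rewrite -(natr1 n.+1); move: (n.+1%:R) => a h1 h2.
by field; rewrite h1 h2.
Qed.

Lemma line_vertexS n : line n n.+2%:R^-1 = harm n.+2 / n.+2%:R :> R.
Proof.
rewrite /line slopeE [harm n.+2]harmS; have := natr_neq0 n; have := natr_neq0 n.+1.
set h := harm _; rewrite -(natr1 n.+1); move: (n.+1%:R) => a h1 h2.
by field; rewrite h1.
Qed.

Lemma slopeS n : slope n.+1 = slope n + n.+3%:R^-1 :> R.
Proof.
rewrite !slopeE [harm n.+2]harmS; have := natr_neq0 n.+1; have := natr_neq0 n.+2.
set h := harm _; rewrite -(natr1 n.+2) -(natr1 n.+1); move: (n.+1%:R) => a h1 h2.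
by field; rewrite h1 h2.
Qed.

Lemma slope_ge0 n : 0 <= slope n :> R.
Proof. by apply: sumr_ge0 => i _; exact: slope_coef_ge0. Qed.

Lemma line_ge0 n (s : R) : 0 <= s -> 0 <= line n s.
Proof. by move=> s0; rewrite addr_ge0 ?invr_ge0// mulr_ge0// slope_ge0. Qed.

Lemma pt_mix_vertical (a c T : R) : 0 < T -> `|c| <= T ->
  exists2 t, 0 <= t <= 1 & pt a c = (1 - t) *: pt a (- T) + t *: pt a T.
Proof.
move=> T0 cT; exists ((c / T + 1) / 2).
  have : -1 <= c / T <= 1 by rewrite -ler_norml normrM normfV (gtr0_norm T0) ler_pdivrMr ?mul1r.
  by lra.
apply: vec2P; rewrite ?mix0 ?mix1 ?pt0 ?pt1; first by ring.
by field; rewrite gt_eqF.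
Qed.

(** The parameter is the same for both signs, so one mixture gives both ends of the vertical segment
    at abscissa [- s]. The factor in [t] is the inverse of the width of the slab. *)
Lemma top_mix n (s : R) : n.+2%:R^-1 <= s <= n.+1%:R^-1 ->
  exists2 t, 0 <= t <= 1 & forall b,
    pt (- s) (sgb b * (1 + line n s)) = (1 - t) *: vertex b n + t *: vertex b n.+1.
Proof.
move=> hs; pose t : R := (n.+1%:R^-1 - s) * (n.+1%:R * n.+2%:R).
have sE : s = (1 - t) * n.+1%:R^-1 + t * n.+2%:R^-1.
  rewrite /t; have := natr_neq0 n; have := natr_neq0 n.+1.
  by rewrite -(natr1 n.+1); move: (n.+1%:R) => a h1 h2; field; rewrite h1 h2.
have ab : n.+2%:R^-1 < n.+1%:R^-1 :> R by rewrite ltf_pV2 ?posrE// ltr_nat.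
clearbody t; exists t.
  move: hs ab sE; set a := n.+1%:R^-1; set c := n.+2%:R^-1 => hs ab sE.
  have h : t * (a - c) = a - s by rewrite {1}sE; ring.
  have ac : 0 < a - c by rewrite subr_gt0.
  move: hs => /andP[cs sa]; apply/andP; split.
    by rewrite -(pmulr_lge0 t ac) h subr_ge0.
  by rewrite -(ler_pM2r ac) mul1r h lerD2l lerN2.
move=> b; apply: vec2P; rewrite ?mix0 ?mix1 ?pt0 ?pt1.
  by rewrite {1}sE; ring.
rewrite -line_vertex -line_vertexS /line.
rewrite {1}sE; ring.
Qed.

Lemma exists_slab (s : R) : 0 < s <= 1 -> exists n, n.+2%:R^-1 <= s <= n.+1%:R^-1.
Proof.
move=> /andP[s0 s1]; have si : 1 <= s^-1 by rewrite invf_ge1.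
have /andP[h1 h2] := truncn_itv (le_trans ler01 si).
have m0 : (0 < Num.truncn s^-1)%N by rewrite truncn_gt0.
move: h1 h2; case: (Num.truncn s^-1) m0 => // n _ h1 h2; exists n.
rewrite -[s]invrK !lef_pV2 ?posrE ?invr_gt0//.
by rewrite (ltW h2) h1.
Qed.

Lemma line0_le (c : R) : (forall n, c <= 1 + line n 0) -> c <= 1.
Proof.
move=> h; apply/ler_addgt0Pr => e e0; apply: le_trans (h (Num.bound e^-1)) _.
rewrite /line mulr0 addr0 lerD2l invf_ple ?posrE//.
apply: ltW; apply: (lt_trans (archi_boundP _)); first by rewrite invr_ge0 ltW.
by rewrite ltr_nat.
Qed.

(** A point lies on the vertical segment of its abscissa, whose ends are on the upper and lower
    chords of some slab or at the ends of the face. The explicit mixtures serve both to realize the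
    point and to list the candidates for extreme points. *)
Lemma region_cases u : region u ->
  (exists2 t, 0 <= t <= 1 & u = (1 - t) *: apex true + t *: apex false) \/
  exists n t1 t2, [/\ 0 <= t1 <= 1, 0 <= t2 <= 1 & u =
    (1 - t1) *: ((1 - t2) *: vertex true n + t2 *: vertex true n.+1) +
    t1 *: ((1 - t2) *: vertex false n + t2 *: vertex false n.+1)].
Proof.
move=> [/andP[um u0] hu].
have uE : u = pt (- - u 0 0) (u 0 1) by apply: vec2P; rewrite ?pt0 ?pt1 ?opprK.
move: u0; rewrite le_eqVlt => /orP[/eqP u0|u0].
  left; have u1 : `|u 0 1| <= 1.
    by apply: line0_le => n; have := hu n; rewrite u0 oppr0.
  have [t ht tE] := pt_mix_vertical 0 ltr01 u1.
  exists t => //; rewrite {1}uE u0 !oppr0 tE; congr (_ *: pt _ _ + _); rewrite /sgb//.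
right; have s01 : 0 < - u 0 0 <= 1 by rewrite oppr_gt0 u0 lerNl um.
have [n hn] := exists_slab s01.
have [t2 ht2 t2E] := top_mix hn.
have T0 : 0 < 1 + line n (- u 0 0) by rewrite ltr_pwDl// line_ge0// oppr_ge0 ltW.
have [t1 ht1 t1E] := pt_mix_vertical (- - u 0 0) T0 (hu n).
exists n, t1, t2; split => //; rewrite -!t2E {1}uE t1E /sgb.
by congr (_ *: pt _ _ + _ *: pt _ _); rewrite ?mulN1r ?mul1r.
Qed.

Lemma RotE : Rot Phi = region.
Proof.
apply/seteqP; split=> u; first exact: Rot_region.
move=> /region_cases[[t ht ->]|[n [t1 [t2 [h1 h2 ->]]]]].
  by apply: Rot_mix => //; exact: Rot_apex.
by apply: Rot_mix => //; apply: Rot_mix => //; exact: Rot_vertex.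
Qed.

End rotation_set.

(** * Extreme points, and the face in the distinguished direction *)

Section polygon.
Context {R : realType}.
Local Notation prob := (probability fullX R).
Local Notation Phi := (@Phi R).
Implicit Types u v w : 'rV[R]_2.

Lemma extreme_mix (K : set 'rV[R]_2) u v w (t : R) : extreme_points K u -> K v -> K w ->
  0 <= t <= 1 -> u = (1 - t) *: v + t *: w -> u = v \/ u = w.
Proof.
move=> [Ku ext] Kv Kw /andP[t0 t1] uE.
move: t0; rewrite le_eqVlt => /orP[/eqP t0|t0].
  by left; rewrite uE -t0 subr0 scale1r scale0r addr0.
move: t1; rewrite le_eqVlt => /orP[/eqP t1|t1].
  by right; rewrite uE t1 subrr scale1r scale0r add0r.
by left; have [->] := ext v w t Kv Kw (introT andP (conj t0 t1)) uE.
Qed.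

Lemma extreme_Rot u : extreme_points (Rot Phi) u ->
  exists b, u = apex b \/ exists n, u = vertex b n.
Proof.
move=> eu; have Ku : region u by case: eu => /Rot_region.
have [[t ht uE]|[n [t1 [t2 [h1 h2 uE]]]]] := region_cases Ku.
  have [->|->] := extreme_mix eu (Rot_apex _) (Rot_apex _) ht uE.
    by exists true; left.
  by exists false; left.
have Rb b := Rot_mix (Rot_vertex b n) (Rot_vertex b n.+1) h2.
have [uE'|uE'] := extreme_mix eu (Rb true) (Rb false) h1 uE.
  exists true; right.
  have [->|->] := extreme_mix eu (Rot_vertex _ _) (Rot_vertex _ _) h2 uE'.
    by exists n.
  by exists n.+1.
exists false; right.
have [->|->] := extreme_mix eu (Rot_vertex _ _) (Rot_vertex _ _) h2 uE'.
  by exists n.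
by exists n.+1.
Qed.

Lemma countable_extreme : countable (extreme_points (Rot Phi)).
Proof.
pose f (i : bool * option nat) : 'rV[R]_2 :=
  if i.2 is Some n then vertex i.1 n else apex i.1.
apply: (@sub_countable _ _ _ (range f)).
  apply: subset_card_le => u /extreme_Rot[b [->|[n ->]]].
    by exists (b, None).
  by exists (b, Some n).
by apply: sub_countable (card_image_le _ _) _; exact: countableP.
Qed.

(** The lines of indices [n] and [n.+1] bound the region from above and meet at this vertex. A
    proper mixture equal to the vertex has both its points on both lines, which cross there only,
    their slopes differing by [1 / (n + 3)]. *)
Lemma extreme_vertex n : extreme_points (Rot Phi) (vertex false n.+1).
Proof.
split; first exact: Rot_vertex.
move=> v w t; rewrite RotE => -[_ hv] [_ hw] /andP[t0 t1] uE.
have e0 := congr1 (fun z : 'rV[R]_2 => z 0 0) uE; have e1 := congr1 (fun z : 'rV[R]_2 => z 0 1) uE.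
rewrite mix0 /vertex pt0 in e0; rewrite mix1 /vertex pt1 /sgb mul1r in e1.
have le_line (z : 'rV[R]_2) m : (forall m, `|z 0 1| <= 1 + line m (- z 0 0)) -> z 0 1 <= 1 + line m (- z 0 0) :> R.
  by move=> /(_ m); exact: le_trans (ler_norm _).
have L1 : line n.+1 (- (- n.+2%:R^-1)) = harm n.+2 / n.+2%:R :> R by rewrite opprK line_vertex.
have L0 : line n (- (- n.+2%:R^-1)) = harm n.+2 / n.+2%:R :> R by rewrite opprK line_vertexS.
have t1' : 0 < 1 - t by rewrite subr_gt0.
have tight m : line m (- (- n.+2%:R^-1)) = harm n.+2 / n.+2%:R :> R ->
    v 0 1 = 1 + line m (- v 0 0) /\ w 0 1 = 1 + line m (- w 0 0).
  move=> Lm; have h1 := le_line v m hv; have h2 := le_line w m hw.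
  have h3 : (1 - t) * (1 + line m (- v 0 0)) + t * (1 + line m (- w 0 0)) =
      (1 - t) * v 0 1 + t * w 0 1.
    by rewrite -e1 -Lm e0 /line; ring.
  have h4 : (1 - t) * (1 + line m (- v 0 0) - v 0 1) + t * (1 + line m (- w 0 0) - w 0 1) = 0.
    by move: h3; lra.
  have p1 : 0 <= (1 - t) * (1 + line m (- v 0 0) - v 0 1) by rewrite mulr_ge0 ?subr_ge0// ltW.
  have p2 : 0 <= t * (1 + line m (- w 0 0) - w 0 1) by rewrite mulr_ge0 ?subr_ge0// ltW.
  have z1 : (1 - t) * (1 + line m (- v 0 0) - v 0 1) = 0 by lra.
  have z2 : t * (1 + line m (- w 0 0) - w 0 1) = 0 by lra.
  move/eqP: z1; rewrite mulf_eq0 gt_eqF//= subr_eq0 => /eqP z1.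
  by move/eqP: z2; rewrite mulf_eq0 gt_eqF//= subr_eq0 => /eqP z2.
have [v0 w0] := tight n L0; have [v1 w1] := tight n.+1 L1.
have uniq (z : 'rV[R]_2) : z 0 1 = 1 + line n (- z 0 0) -> z 0 1 = 1 + line n.+1 (- z 0 0) ->
    z = vertex false n.+1.
  move=> z0 z1.
  have d0 : n.+3%:R^-1 != 0 :> R by rewrite invr_eq0 natr_neq0.
  have zx : z 0 0 = - n.+2%:R^-1.
    move: z0 L0; rewrite z1 -L1 /line slopeS => z0 L0.
    apply: (mulfI d0); move: z0 L0; set a := n.+2%:R^-1; set c := n.+3%:R^-1; lra.
  apply: vec2P; rewrite /vertex ?pt0 ?pt1 // z0 zx L0 /sgb mul1r//.
by split; apply: uniq.
Qed.

Lemma infinite_extreme : infinite_set (extreme_points (Rot Phi)).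
Proof.
have sub : range (fun n => vertex false n.+1) `<=` extreme_points (Rot Phi).
  by move=> _ [n _ <-]; exact: extreme_vertex.
apply: sub_infinite_set sub _; apply/infiniteP.
suff /inj_card_eq/card_eqPle[] : {in [set: nat] &, injective (fun n => @vertex R false n.+1)} by [].
move=> m n _ _ /(congr1 (fun u : 'rV[R]_2 => u 0 0)); rewrite /vertex !pt0 => /oppr_inj /invr_inj.
by move/eqP; rewrite eqr_nat => /eqP [].
Qed.

Lemma closed_le_fun (T : topologicalType) (f g : T -> R) :
  continuous f -> continuous g -> closed [set x | f x <= g x].
Proof.
move=> cf cg.
rewrite (_ : [set x | _] = (fun x => g x - f x) @^-1` [set y | 0 <= y]).
  apply: preimage_closed; last exact: closed_ge.
  by move=> x _; apply: cvgB; [exact: cg|exact: cf].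
by apply/seteqP; split=> x /=; rewrite subr_ge0.
Qed.

Lemma closed_below_line (T : topologicalType) (f g : T -> R) n :
  continuous f -> continuous g -> closed [set x | `|g x| <= 1 + line n (- f x)].
Proof.
move=> cf cg; apply: closed_le_fun => x; first by apply: cvg_norm; exact: cg.
apply: cvgD; first exact: cvg_cst.
apply: cvgD; first exact: cvg_cst.
by apply: cvgM; [exact: cvg_cst|apply: cvgN; exact: cf].
Qed.

Lemma compact_region : compact (@region R).
Proof.
apply: bounded_closed_compact.
  exists 2; split; first exact: num_real.
  move=> M M2 u [/andP[h1 h2] /(_ 0%N) h3].
  have u0 : `|u 0 0| <= M.
    by rewrite ler0_norm// lerNl (le_trans _ h1)// lerN2 (le_trans _ (ltW M2))// ler1n.
  have u1 : `|u 0 1| <= M.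
    apply: (le_trans h3); apply: (le_trans _ (ltW M2)).
    rewrite /line /slope big_ord1 invr1; move: h1 h2; lra.
  rewrite /Num.norm /= mx_normrE; apply/bigmax_leP; split.
    exact: le_trans (normr_ge0 _) u0.
  by move=> [i j] _ /=; rewrite ord1; move: j; apply: forall_ord2.
pose c i u : R := u 0 i.
have cc i : continuous (c i : 'rV[R]_2 -> R) by exact: coord_continuous.
have -> : @region R = [set u | -1 <= c 0 u] `&` ([set u | c 0 u <= 0] `&`
    \bigcap_n [set u | `|c 1 u| <= 1 + line n (- c 0 u)]).
  apply/seteqP; split=> u.
    by move=> [/andP[h1 h2] h3]; split => //; split => // n _; exact: h3.
  by move=> [h1 [h2 h3]]; split=> [|n]; [apply/andP|exact: h3].
apply: closedI.
  by apply: (@closed_le_fun _ (fun=> -1) (c 0)); [exact: cst_continuous|exact: cc].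
apply: closedI.
  by apply: (@closed_le_fun _ (c 0) (fun=> 0)); [exact: cc|exact: cst_continuous].
apply: closed_bigI => n _.
exact: closed_below_line (cc 0) (cc 1).
Qed.

Lemma convex_Rot : convex_set (Rot Phi : set (convex_lmodType 'rV[R]_2)).
Proof.
move=> x y l /set_mem Rx /set_mem Ry; apply/mem_set.
have -> : conv l x y = (1 - l%:num) *: (y : 'rV[R]_2) + l%:num *: (x : 'rV[R]_2).
  by rewrite addrC.
by apply: Rot_mix => //; rewrite ge0 le1.
Qed.

Lemma interior_region : (@region R)° !=set0.
Proof.
(* The radius keeps the abscissa between -1 and 0 and the ordinate below 1 in absolute value, under
   all the lines. *)
exists (pt (- 2^-1) 0); apply/nbhs_ballP; exists 2^-1 => //= u [_ hu].
have := hu 0 0; have := hu 0 1; rewrite /ball /= pt0 pt1 sub0r normrN => h1 h0.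
have u0 : -1 <= u 0 0 <= 0.
  by move: h0; rewrite ltr_norml; lra.
split => // n; apply: (@le_trans _ _ 1); first by apply: ltW; apply: lt_trans h1 _; lra.
by rewrite lerDl line_ge0// oppr_ge0; case/andP: u0.
Qed.

Lemma polygon_Rot : infinite_polygon (Rot Phi).
Proof.
split.
- rewrite RotE; exact: compact_region.
- exact: convex_Rot.
- rewrite RotE; exact: interior_region.
- exact: infinite_extreme.
- exact: countable_extreme.
Qed.

Definition alpha : 'rV[R]_2 := pt 1 0.

Lemma dot_alpha u : dot alpha u = u 0 0.
Proof. by rewrite dotE /alpha pt0 pt1 mul1r mul0r addr0. Qed.

Lemma face_alphaE : face Phi alpha = [set u | Rot Phi u /\ u 0 0 = 0].
Proof.
apply/seteqP; split=> u [Ku].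
  move=> [_ /(_ 0)]; rewrite dot_alpha => h; split => //; apply/eqP; rewrite eq_le.
  have [/andP[_ ->] _] := Rot_region Ku; rewrite h//.
  by exists (apex true); [exact: Rot_apex|rewrite dot_alpha /apex pt0].
move=> u0; split => //; rewrite /support_line /= dot_alpha u0; split.
  by exists u => //; rewrite dot_alpha.
by move=> _ [v Kv <-]; rewrite dot_alpha; have [/andP[]] := Rot_region Kv.
Qed.

Lemma face_alpha_le u : face Phi alpha u -> u = pt 0 (u 0 1) /\ `|u 0 1| <= 1.
Proof.
rewrite face_alphaE => -[Ku u0]; split.
  by apply: vec2P; rewrite ?pt0 ?pt1.
have [_ hu] := Rot_region Ku.
by apply: line0_le => n; have := hu n; rewrite u0 oppr0.
Qed.

Lemma face_alpha : face Phi alpha = closed_segment (apex true) (apex false).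
Proof.
apply/seteqP; split=> u.
  move=> /face_alpha_le[uE u1].
  have [t ht tE] := pt_mix_vertical 0 ltr01 u1.
  by exists t => //; rewrite uE tE.
move=> [t /= ht <-]; rewrite face_alphaE; split.
  by apply: Rot_mix => //; exact: Rot_apex.
by rewrite mix0 /apex !pt0 !mulr0 addr0.
Qed.

Lemma harm_unbounded (c : R) : exists n, c < harm n.+1.
Proof.
apply: contrapT => /forallNP h; apply: (@dvg_harmonic R).
have sE n : series (@harmonic R) n = harm n by rewrite /series /= big_mkord.
apply: nondecreasing_is_cvgn.
  by apply: nondecreasing_series => n _ _; rewrite /= invr_ge0.
exists c => _ [n _ <-]; rewrite sE; have /negP := h n.
rewrite -leNgt harmS; apply: le_trans; by rewrite lerDl invr_ge0.
Qed.

(** On the face [dot p] is at most [|p 0 1|]. The vertex of index [n] on the side of [p 0 1] adds to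
    this [1 / (n + 1)] times [|p 0 1| * harm n.+1 - p 0 0], which is positive for some [n] when
    [p 0 1] is nonzero. Otherwise [p] is opposite to [alpha], and the vertex of abscissa -1 does
    better than the face. *)
Lemma face_alpha_exposed (p : 'rV[R]_2) u : direction p -> p != alpha ->
  face Phi alpha u -> exists2 v, Rot Phi v & dot p u < dot p v.
Proof.
move=> pd pa /face_alpha_le[->]; rewrite pt1 => u1; set y := u 0 1 in u1 *.
have [p1|p1] := eqVneq (p 0 1) 0.
  exists (vertex false 0); first exact: Rot_vertex.
  rewrite !dotE p1 /vertex !pt0 !mul0r mulr0 !addr0 invr1 mulrN1 oppr_gt0.
  move: pd; rewrite /direction /= dotE p1 mulr0 addr0 => pd.
  rewrite ltNge; apply: contra pa => p0; apply/eqP/vec2P; rewrite /alpha ?pt0 ?pt1//.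
  by apply/eqP; rewrite -(eqrXn2 (n := 2))// expr1n expr2 pd.
have ap : 0 < `|p 0 1| by rewrite normr_gt0.
have [n hn] := harm_unbounded (p 0 0 / `|p 0 1|).
exists (vertex (p 0 1 < 0) n); first exact: Rot_vertex.
rewrite !dotE /vertex !pt0 !pt1 mulr0 add0r mulrA.
have -> : p 0 1 * sgb (p 0 1 < 0) = `|p 0 1|.
  rewrite /sgb; case: ltrP => h; first by rewrite mulrN1 ltr0_norm.
  by rewrite mulr1 ger0_norm.
apply: (@le_lt_trans _ _ `|p 0 1|).
  by apply: le_trans (ler_norm _) _; rewrite normrM; apply: ler_piMr.
rewrite mulrDr mulr1 addrCA ltrDl mulrN mulrA -mulNr -mulrDl.
apply: divr_gt0 => //; rewrite addrC subr_gt0.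
by rewrite mulrC -ltr_pdivrMr.
Qed.

End polygon.

Theorem theoremC (R : realType) :
  exists (Phi : fullX -> 'rV[R]_2) (alpha a b : 'rV[R]_2),
    [/\ continuous Phi, direction alpha,
        a != b /\ face Phi alpha = closed_segment a b,
        infinite_polygon (Rot Phi)
      & (exists mu_alpha : probability fullX R,
           [/\ is_singleton_measure (GS Phi alpha) mu_alpha,
               ~ ergodic full_shift mu_alpha
             & open_segment a b (rv Phi mu_alpha)])
        /\ (forall alpha' : 'rV[R]_2, direction alpha' -> alpha' != alpha ->
              rv Phi @` GS Phi alpha' `&` face Phi alpha = set0)].
Proof.
exists (@Phi R), (@alpha R), (apex true), (apex false); split.
- exact: Phi_continuous.
- by rewrite /direction /= dotE /alpha pt0 pt1 mul1r mul0r addr0.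
- split; last exact: face_alpha.
  apply/eqP => /(congr1 (fun u : 'rV[R]_2 => u 0 1)).
  by rewrite /apex !pt1 /sgb; lra.
- exact: polygon_Rot.
split.
  have [mu [muE muI inv muW]] := @fixed_points_measure R.
  exists mu; split.
  - have -> : GS (@Phi R) (@alpha R) = ground_states phi1.
      rewrite /GS; congr ground_states; apply/funext => x.
      by rewrite dot_alpha /Phi pt0.
    exact: ground_states_phi1.
  - move=> [_ erg].
    (* The sequences that are eventually [ord0]: unlike the fixed point alone, this set equals its
       preimage, and it contains exactly one of the four fixed points. *)
    pose A : set fullX := \bigcup_n \bigcap_j ((fun x : fullX => x (n + j)%N) @^-1` [set ord0]).
    have mA : measurable A.
      apply: bigcupT_measurable => n; apply: bigcapT_measurable => j.
      exact: measurable_coord.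
    have invA : full_shift @^-1` A = A.
      apply/seteqP; split=> x [n _ hn].
        by exists n.+1 => // j _; have := hn j I; rewrite /= /full_shift addSn.
      by exists n => // j _; have := hn j.+1 I; rewrite /= /full_shift addnS.
    have dA a : (\d_(const_seq a) A = (a == ord0)%:R%:E)%E.
      rewrite /dirac indicE; congr ((nat_of_bool _)%:R%:E).
      by apply/idP/eqP => [/set_mem[n _ /(_ 0%N I)]//|->]; apply/mem_set; exists 0%N.
    have muA : mu A = (4^-1)%:E.
      rewrite muE (bigD1 ord0)//= big1 ?adde0; first by rewrite dA eqxx mule1.
      by move=> a /negPf a0; rewrite dA a0 mule0.
    by have [] := erg A mA invA; rewrite muA => -[]; lra.
  (* The signs of the four letters cancel, so the rotation vector is the midpoint of the face. *)
  - exists 2^-1; first by rewrite /=; lra.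
    rewrite rvE; apply: vec2P; rewrite ?mix0 ?mix1 /apex ?pt0 ?pt1.
      rewrite muI; last exact: bmeas_phi1.
      by rewrite big1 ?mulr0 ?addr0// => a _; rewrite /phi1 /const_seq eqxx.
    rewrite muI; last exact: bmeas_phi2.
    under eq_bigr do rewrite phi2_const.
    by rewrite !big_ord_recl big_ord0 /letter_sign /sgb /=; lra.
move=> p pd pa; apply/seteqP; split => // u [[nu gnu <-] fu].
(* Some invariant measure has a larger integral in the direction [p] than any point of the face,
   while a ground state maximizes that integral. *)
have [v [eta inveta <-]] := face_alpha_exposed pd pa fu.
rewrite !dot_rv ltNge => /negP; apply.
by apply: ground_states_max => //; exact: dot_Phi_continuous.
Qed.
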